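(* Let $r>0$ and let $\mu$ be an in-homogeneous self-similar measure on $\mathbb{R}^q$ belonging to Case (i) or Case (ii) (as defined in the context), with associated numbers $\xi_{1,r},\xi_{2,r}>0$ and $\xi_r=\max\{\xi_{1,r},\xi_{2,r}\}$. Assume that $\xi_{1,r}=\xi_{2,r}$. Then: (a) if $\mu$ is in Case (i), then $$n^{-\frac{r}{\xi_r}}\cdot\log n\ \lesssim\ e^r_{n,r}(\mu)\ \lesssim\ n^{-\frac{r}{\xi_r}}\cdot(\log n)^{\frac{\xi_r+r}{\xi_r}};$$ (b) if $\mu$ is in Case (ii), then $$e_{n,r}^r(\mu)\asymp n^{-\frac{r}{\xi_r}}(\log n)^{\frac{\xi_r+r}{\xi_r}}.$$
   Context: **In-homogeneous self-similar measures (ISM).** Let $N\ge 2$ and let $(f_i)_{i=1}^N$ be contractive similitudes on $\mathbb{R}^q$ with contraction ratios $(s_i)_{i=1}^N$, $s_i\in(0,1)$. Let $E$ be the associated self-similar set, i.e. the unique non-empty compact set with $E=f_1(E)\cup\cdots\cup f_N(E)$. Let $\nu$ be a Borel probability measure on $\mathbb{R}^q$ with compact support $C$, and $(p_i)_{i=0}^N$ a probability vector with $p_i>0$ for all $0\le i\le N$. There is a unique Borel probability measure $\mu$ with $\mu=p_0\nu+\sum_{i=1}^N p_i\,\mu\circ f_i^{-1}$; it is called the ISM associated with $(f_i)_{i=1}^N$, $(p_i)_{i=0}^N$ and $\nu$. For contractive similitudes $(g_i)_{i=1}^M$ and a probability vector $(t_i)_{i=1}^M$, the associated self-similar measure is the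 unique Borel probability measure $\nu$ with $\nu=\sum_{i=1}^M t_i\,\nu\circ g_i^{-1}$. The family $(g_i)_{i=1}^M$ satisfies the open set condition (OSC) if there is a non-empty bounded open set $U$ such that the sets $g_i(U)$, $1\le i\le M$, are pairwise disjoint and $\bigcup_{i=1}^M g_i(U)\subset U$. **Case (i).** $(f_i)_{i=1}^N$ satisfies the OSC, and $\nu$ is the self-similar measure associated with the same family $(f_i)_{i=1}^N$ and a probability vector $(t_i)_{i=1}^N$ with all $t_i>0$. In this case $\xi_{1,r},\xi_{2,r}$ are the positive numbers defined by $$\sum_{i=1}^N(t_is_i^r)^{\frac{\xi_{1,r}}{\xi_{1,r}+r}}=1,\qquad \sum_{i=1}^N(p_is_i^r)^{\frac{\xi_{2,r}}{\xi_{2,r}+r}}=1.$$ **Case (ii).** $M\ge 2$, $(g_i)_{i=1}^M$ are contractive similitudes on $\mathbb{R}^q$ with contraction ratios $(c_i)_{i=1}^M$ satisfying the OSC, $\nu$ is the self-similar measure associated with $(g_i)_{i=1}^M$ and a probability vector $(t_i)_{i=1}^M$ with all $t_i>0$ (so $C$ is the self-similar set of $(g_i)_{i=1}^M$), and there exists a bounded non-empty open set $U\subset\mathbb{R}^q$ such that (1) $\bigcup_{i=1}^N f_i(U)\subset U$ and $f_i(U)\cap f_j(U)=\emptyset$ for $1\le i\ne j\le N$; (2) $E\cap U\ne\emptyset$ and $C\subset U$; (3) $\nu(\partial U)=0$, and $C\cap f_i(\mathrm{cl}(U))=\emptyset$ for all $1\le i\le N$. In this case $\xi_{1,r},\xi_{2,r}$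 are the positive numbers defined by $$\sum_{i=1}^M(t_ic_i^r)^{\frac{\xi_{1,r}}{\xi_{1,r}+r}}=1,\qquad \sum_{i=1}^N(p_is_i^r)^{\frac{\xi_{2,r}}{\xi_{2,r}+r}}=1.$$ In both cases $\xi_r:=\max\{\xi_{1,r},\xi_{2,r}\}$. **Quantization.** For a Borel probability measure $P$ on $\mathbb{R}^q$ and $n\ge1$, the $n$th quantization error of order $r$ is $$e_{n,r}(P)=\inf_{\alpha\subset\mathbb{R}^q,\ 1\le \mathrm{card}(\alpha)\le n}\Big(\int d(x,\alpha)^r\,dP(x)\Big)^{1/r},$$ where $d(x,\alpha)$ is the Euclidean distance from $x$ to $\alpha$; $e_{n,r}^r(P)$ denotes $(e_{n,r}(P))^r$. **Asymptotic notation.** For sequences $(a_n),(b_n)$: $a_n\lesssim b_n$ (resp. $a_n\gtrsim b_n$) means that there is a constant $B>0$ with $a_n\le B b_n$ (resp. $a_n\ge B b_n$) for all large $n$; $a_n\asymp b_n$ means $a_n\lesssim b_n$ and $a_n\gtrsim b_n$. *)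

(* Defs.v *)
From HB Require Import structures.
From mathcomp Require Import all_boot all_order all_algebra.
From mathcomp Require Import all_classical all_reals all_analysis.

Set Implicit Arguments.
Unset Strict Implicit.
Unset Printing Implicit Defensive.

Import Order.TTheory GRing.Theory Num.Theory.
Import numFieldNormedType.Exports.

Local Open Scope classical_set_scope.
Local Open Scope ring_scope.

(* R^q with its Borel sigma-algebra.  The topology of 'rV[R]_q is induced by
   the sup norm; it is the Euclidean topology, and boundedness is the same for
   both norms. *)
Notation borel R q := (g_sigma_algebraType (@open 'rV[R]_q)).

(* The library's norm on 'rV[R]_q is the sup norm, hence this one. *)
Definition enorm (R : realType) (q : nat) (x : 'rV[R]_q) : R :=
  Num.sqrt (\sum_i x 0 i ^+ 2).

Definition contractive_similitude (R : realType) (q : nat)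
    (f : 'rV[R]_q -> 'rV[R]_q) (s : R) : Prop :=
  0 < s < 1 /\ forall x y, enorm (f x - f y) = s * enorm (x - y).

Definition pos_prob_vector (R : realType) (n : nat) (p : 'I_n -> R) : Prop :=
  (forall i, 0 < p i) /\ \sum_i p i = 1.

Definition self_similar_set (R : realType) (q N : nat)
    (f : 'I_N -> 'rV[R]_q -> 'rV[R]_q) (E : set 'rV[R]_q) : Prop :=
  [/\ E !=set0, compact E & E = \bigcup_i (f i @` E)].

Definition open_set_condition (R : realType) (q M : nat)
    (g : 'I_M -> 'rV[R]_q -> 'rV[R]_q) : Prop :=
  exists U : set 'rV[R]_q,
    [/\ U !=set0, open U, bounded_set U,
        trivIset setT (fun i => g i @` U) & \bigcup_i (g i @` U) `<=` U].

Definition msupport (R : realType) (q : nat) (P : probability (borel R q) R)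
    : set 'rV[R]_q :=
  [set x | forall V : set 'rV[R]_q, open V -> V x -> (0 < P V)%E].

Definition boundary (T : topologicalType) (A : set T) : set T :=
  closure A `\` A°.

Definition self_similar_measure (R : realType) (q M : nat)
    (g : 'I_M -> 'rV[R]_q -> 'rV[R]_q) (t : 'I_M -> R)
    (P : probability (borel R q) R) : Prop :=
  forall A : set 'rV[R]_q, measurable (A : set (borel R q)) ->
    P A = (\sum_(i < M) (t i)%:E * P (g i @^-1` A))%E.

(* The weights (p_0, ..., p_N) are indexed by 'I_N.+1; p_i, for 1 <= i <= N,
   is attached to the i-th map and is [p (lift ord0 i)] with i : 'I_N. *)
Definition ISM (R : realType) (q N : nat)
    (f : 'I_N -> 'rV[R]_q -> 'rV[R]_q) (p : 'I_N.+1 -> R)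
    (nu mu : probability (borel R q) R) : Prop :=
  forall A : set 'rV[R]_q, measurable (A : set (borel R q)) ->
    mu A = ((p ord0)%:E * nu A
            + \sum_(i < N) (p (lift ord0 i))%:E * mu (f i @^-1` A))%E.

Definition is_xi (R : realType) (n : nat) (w s : 'I_n -> R) (r xi : R) : Prop :=
  0 < xi /\ \sum_i (w i * s i `^ r) `^ (xi / (xi + r)) = 1.

Definition case_i (R : realType) (q N : nat)
    (f : 'I_N -> 'rV[R]_q -> 'rV[R]_q) (t : 'I_N -> R)
    (nu : probability (borel R q) R) : Prop :=
  [/\ open_set_condition f, pos_prob_vector t & self_similar_measure f t nu].

Definition case_ii (R : realType) (q N M : nat)
    (f : 'I_N -> 'rV[R]_q -> 'rV[R]_q) (E : set 'rV[R]_q)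
    (g : 'I_M -> 'rV[R]_q -> 'rV[R]_q) (c t : 'I_M -> R)
    (nu : probability (borel R q) R) : Prop :=
  [/\ (2 <= M)%N,
      forall i, contractive_similitude (g i) (c i),
      open_set_condition g,
      pos_prob_vector t /\ self_similar_measure g t nu &
      exists U : set 'rV[R]_q,
        [/\ [/\ bounded_set U, U !=set0 & open U],
            \bigcup_i (f i @` U) `<=` U /\ trivIset setT (fun i => f i @` U),
            E `&` U !=set0 /\ msupport nu `<=` U &
            nu (boundary U) = 0%E /\
            forall i, msupport nu `&` (f i @` closure U) = set0]].

Definition dist_to (R : realType) (q : nat) (x : 'rV[R]_q)
    (alpha : set 'rV[R]_q) : R :=
  inf [set enorm (x - a) | a in alpha].

Definition quant_error (R : realType) (q : nat) (r : R)
    (P : probability (borel R q) R) (n : nat) : \bar R :=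
  ereal_inf [set ((\int[P]_x (dist_to x alpha `^ r)%:E) `^ r^-1)%E
            | alpha in [set alpha : set 'rV[R]_q |
                         alpha !=set0 /\ (alpha #<= `I_n)%card]].

Definition lesssim (R : realType) (a b : nat -> \bar R) : Prop :=
  exists2 B : R, 0 < B & \forall n \near \oo, (a n <= B%:E * b n)%E.

Definition gtrsim (R : realType) (a b : nat -> \bar R) : Prop :=
  exists2 B : R, 0 < B & \forall n \near \oo, (B%:E * b n <= a n)%E.

Definition asymp (R : realType) (a b : nat -> \bar R) : Prop :=
  lesssim a b /\ gtrsim a b.

(* Main.v *)
Require Import Defs.
From HB Require Import structures.
From mathcomp Require Import all_boot all_order all_algebra.
From mathcomp Require Import all_classical all_reals all_analysis.
From mathcomp Require Import measurable_realfun.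
From mathcomp Require Import ring lra.

Set Implicit Arguments.
Unset Strict Implicit.
Unset Printing Implicit Defensive.

Import Order.TTheory GRing.Theory Num.Theory.
Import numFieldNormedType.Exports.

Local Open Scope classical_set_scope.
Local Open Scope ring_scope.

(** The proof rests on a recursion for the cost [cost r P A], the integral of the
    [r]-th power of the distance to [A].  Let [P = w0 Q + \sum_i w i (f i)_* P] and
    [h i = w i * s i `^ r].  By linearity and scaling, the cost of approximating
    [P] is the cost of [Q] with weight [w0], plus the costs of the copies of [P]
    with weights [h i] ([cost_rec_le], [cost_rec_ge]).  With
    [kap = xi / (xi + r)], the equation for [xi] reads [\sum_i h i `^ kap = 1].

    Instead of the number [n] of points, the inductions use a budget [x]: a
    measure with budget [x] deserves about [x `^ kap] points and then has cost
    about [x `^ (kap - 1)], and it gives the budget [x * h i] to its [i]-th piece.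
    Because [\sum_i h i `^ kap = 1], these two quantities are additive over the
    pieces, and any bound of this shape propagates from one generation to the
    next.

    Upper bounds.  A self-similar measure achieves these orders
    ([self_similar_upper]).  For [mu], each generation requires in addition one
    share of points for [nu], which has the same exponent.  After [k] generations,
    with [k] of order [ln n], there are [k * x `^ kap] points and the cost is
    [k * x `^ (kap - 1)] ([upper_recursion]); eliminating [x] gives
    [n `^ (- r / xi) * ln n `^ ((xi + r) / xi)] ([upper_asymptotics]).

    Lower bounds.  Let [U] be an open set whose images under the maps are disjoint
    subsets of [U], and let the complement of [U] be added to the approximating
    set.  Then the points lying in one piece are of no use for the others, so that
    they are shared out among the pieces.  A bound [(x `^ kap - n) / x] on the cost
    is linear in the number [n] of points, hence stable under the recursion
    ([lower_self_similar]).  For [mu] in Case (i), a point may serve both [nu] and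
    a piece, and the [k] generations multiply the constant: the bound is
    [k * (x `^ kap - n) / x], which yields the factor [ln n].  In Case (ii), the
    support of [nu] stays away from the pieces, each point is counted once, and the
    bound becomes [(k * x `^ kap - n) / x], which yields the larger power of
    [ln n] ([lower_mixture], [lower_mixture_separated]).

    The lower recursion for [nu] starts only if the complement of [U] has positive
    cost, that is, if [nu] charges [U].  Schief's theorem that the open set
    condition implies the strong one provides such a set
    ([strong_open_set_condition]); its combinatorial core is to maximise the number
    of neighbours of a piece, which is finite by a packing argument. *)

(** * Euclidean norm and similitudes *)

Section EuclideanNorm.
Variables (R : realType) (q : nat).
Implicit Types x y z : 'rV[R]_q.

Definition dot x y : R := \sum_i x 0 i * y 0 i.

Lemma enormE x : enorm x = Num.sqrt (dot x x).
Proof. by congr Num.sqrt; apply: eq_bigr => i _; rewrite expr2. Qed.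

Lemma dotDl x y z : dot (x + y) z = dot x z + dot y z.
Proof. by rewrite -big_split; apply: eq_bigr => i _; rewrite mxE mulrDl. Qed.

Lemma dotC x y : dot x y = dot y x.
Proof. by apply: eq_bigr => i _; rewrite mulrC. Qed.

Lemma dotZl a x y : dot (a *: x) y = a * dot x y.
Proof. by rewrite mulr_sumr; apply: eq_bigr => i _; rewrite mxE mulrA. Qed.

Lemma dotNl x y : dot (- x) y = - dot x y.
Proof. by rewrite -scaleN1r dotZl mulN1r. Qed.

Lemma dotDr x y z : dot x (y + z) = dot x y + dot x z.
Proof. by rewrite dotC dotDl !(dotC x). Qed.

Lemma dotZr a x y : dot x (a *: y) = a * dot x y.
Proof. by rewrite dotC dotZl dotC. Qed.

Lemma dotNr x y : dot x (- y) = - dot x y.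
Proof. by rewrite dotC dotNl dotC. Qed.

Lemma dot_ge0 x : 0 <= dot x x.
Proof. by apply: sumr_ge0 => i _; rewrite -expr2 sqr_ge0. Qed.

Lemma dot_enorm x : dot x x = enorm x ^+ 2.
Proof. by rewrite enormE sqr_sqrtr ?dot_ge0. Qed.

Lemma enorm_ge0 x : 0 <= enorm x.
Proof. exact: sqrtr_ge0. Qed.

Lemma enormZ a x : enorm (a *: x) = `|a| * enorm x.
Proof.
by rewrite !enormE dotZl dotZr mulrA -expr2 sqrtrM ?sqr_ge0// sqrtr_sqr.
Qed.

Lemma enormN x : enorm (- x) = enorm x.
Proof. by rewrite -scaleN1r enormZ normrN1 mul1r. Qed.

Lemma enorm0 : enorm (0 : 'rV[R]_q) = 0.
Proof. by rewrite -(scale0r (0 : 'rV[R]_q)) enormZ normr0 mul0r. Qed.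

Lemma enormB x y : enorm (x - y) = enorm (y - x).
Proof. by rewrite -enormN opprB. Qed.

Lemma coord_le_enorm x i : `|x 0 i| <= enorm x.
Proof.
rewrite -sqrtr_sqr ler_wsqrtr// (bigD1 i)//= lerDl.
by apply: sumr_ge0 => j _; exact: sqr_ge0.
Qed.

Lemma enorm_eq0 x : enorm x = 0 -> x = 0.
Proof.
move=> x0; apply/rowP => i; rewrite mxE; apply/eqP; rewrite -normr_le0 -x0.
exact: coord_le_enorm.
Qed.

Lemma cauchy_schwarz x y : dot x y <= enorm x * enorm y.
Proof.
have [/eqP/enorm_eq0 ->|x0] := boolP (enorm x == 0).
  by rewrite enorm0 mul0r -(scale0r 0) dotZl mul0r.
have [/eqP/enorm_eq0 ->|y0] := boolP (enorm y == 0).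
  by rewrite enorm0 mulr0 -(scale0r 0) dotZr mul0r.
have ab0 : 0 < enorm x * enorm y by rewrite mulr_gt0// lt_def ?x0 ?y0 enorm_ge0.
have := dot_ge0 (enorm y *: x - enorm x *: y).
rewrite dotDl !dotDr !dotNl !dotNr !dotZl !dotZr (dotC y x) !dot_enorm => h.
have : 0 <= 2 * (enorm x * enorm y) * (enorm x * enorm y - dot x y).
  by apply: le_trans h _; rewrite le_eqVlt; apply/orP; left; apply/eqP; ring.
by rewrite pmulr_rge0 ?subr_ge0// mulr_gt0.
Qed.

Lemma enormD x y : enorm (x + y) <= enorm x + enorm y.
Proof.
rewrite -(@ler_pXn2r _ 2)// ?nnegrE ?addr_ge0 ?enorm_ge0//.
rewrite -dot_enorm dotDl !dotDr sqrrD !dot_enorm (dotC y x).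
have := cauchy_schwarz x y; lra.
Qed.

Lemma enorm_triangle x y z : enorm (x - z) <= enorm (x - y) + enorm (y - z).
Proof. by apply: le_trans (enormD _ _); rewrite addrA subrK. Qed.

Lemma mx_norm_le_enorm x : `|x| <= enorm x.
Proof.
rewrite /Num.Def.normr /= mx_normrE.
by apply: bigmax_le => [|[i j] _]; rewrite ?enorm_ge0//= ord1 coord_le_enorm.
Qed.

Lemma coord_le_mx_norm x i : `|x 0 i| <= `|x|.
Proof.
rewrite [leRHS]/Num.Def.normr /= mx_normrE.
by apply: (@le_bigmax_cond _ _ _ 0 (0, i) xpredT (fun k => `|x k.1 k.2|)).
Qed.

(** The two norms on R^q are equivalent, so Euclidean distances may be used to
    speak about the product topology. *)
Lemma enorm_le_mx_norm x : enorm x <= q%:R * `|x|.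
Proof.
rewrite -(@ler_pXn2r _ 2)// ?nnegrE ?mulr_ge0 ?enorm_ge0//.
rewrite -dot_enorm; apply: (@le_trans _ _ (\sum_(i < q) `|x| ^+ 2)).
  apply: ler_sum => i _; rewrite -expr2 -real_normK ?num_real//.
  by rewrite lerXn2r ?nnegrE// coord_le_mx_norm.
rewrite sumr_const card_ord exprMn -[leLHS]mulr_natl ler_wpM2r ?sqr_ge0//.
by rewrite -natrX ler_nat -mulnn; case: (q) => // k; rewrite leq_pmulr.
Qed.

End EuclideanNorm.

Section Similitude.
Variables (R : realType) (q : nat).
Implicit Types (x y : 'rV[R]_q) (f : 'rV[R]_q -> 'rV[R]_q).

Definition similitude f (s : R) : Prop :=
  0 < s /\ forall x y, enorm (f x - f y) = s * enorm (x - y).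

Lemma contractive_similitudeW f s : contractive_similitude f s -> similitude f s.
Proof. by move=> [/andP[s0 _] h]; split. Qed.

Lemma similitude_inj f s : similitude f s -> injective f.
Proof.
move=> [s0 h] x y fxy; apply/eqP; rewrite -subr_eq0; apply/eqP/enorm_eq0/eqP.
have /eqP := h x y; rewrite fxy subrr enorm0 eq_sym mulf_eq0 => /orP[|//].
by move: s0 => /[swap] /eqP -> ; rewrite ltxx.
Qed.

(** After normalisation, a similitude preserves scalar products, so that it
    sends the canonical basis to an orthonormal family [A]; as [A *m A^T = 1]
    forces [A^T *m A = 1], it is the linear bijection [x |-> x *m A]. *)
Lemma similitude_surj f s y : similitude f s -> exists x, f x = y.
Proof.
move=> [s0 h].
pose g x := s^-1 *: (f x - f 0).
have gd x x' : enorm (g x - g x') = enorm (x - x').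
  rewrite /g -scalerBr enormZ opprB addrA subrK h gtr0_norm ?invr_gt0//.
  by rewrite mulKf// gt_eqF.
have gn x : enorm (g x) = enorm x.
  by have := gd x 0; rewrite {2}/g subrr scaler0 !subr0.
have gdot x x' : dot (g x) (g x') = dot x x'.
  have e2 u v : dot u v = (enorm u ^+ 2 + enorm v ^+ 2 - enorm (u - v) ^+ 2) / 2.
    rewrite -!dot_enorm dotDl !dotDr !dotNl !dotNr (dotC v u); lra.
  by rewrite !e2 gd !gn.
pose A := \matrix_(i < q) g (delta_mx 0 i).
have dotE (u v : 'rV[R]_q) : dot u v = (u *m v^T) 0 0.
  by rewrite mxE; apply: eq_bigr => i _; rewrite mxE.
have AAT : A *m A^T = 1%:M.
  apply/matrixP => i j; rewrite mxE.
  transitivity (dot (g (delta_mx 0 i)) (g (delta_mx 0 j))).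
    by apply: eq_bigr => k _; rewrite !mxE.
  rewrite gdot dotE trmx_delta mul_delta_mx_cond !mxE/=.
  by case: (i == j); rewrite ?mulr1n ?mulr0n ?mxE//=.
have gA x : g x *m A^T = x.
  apply/rowP => i; rewrite mxE; transitivity (dot (g x) (g (delta_mx 0 i))).
    by apply: eq_bigr => k _; rewrite !mxE.
  rewrite gdot /dot (bigD1 i)//= !mxE !eqxx mulr1 big1 ?addr0// => j ji.
  by rewrite mxE (negbTE ji) andbF mulr0.
exists ((s^-1 *: (y - f 0)) *m A^T); set x := _ *m _.
have : g x = s^-1 *: (y - f 0).
  by rewrite -[LHS]mulmx1 -(mulmx1C AAT) mulmxA gA /x -mulmxA (mulmx1C AAT) mulmx1.
move/(congr1 (fun u => s *: u)); rewrite /g !scalerA divff ?gt_eqF// !scale1r.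
exact: addIr.
Qed.

Lemma similitude_inv f s : similitude f s ->
  exists2 g, similitude g s^-1 & cancel g f /\ cancel f g.
Proof.
move=> sf; have [g gK] := choice (fun y => similitude_surj y sf).
exists g; last by split=> // x; apply: (similitude_inj sf).
case: sf => s0 h; split; first by rewrite invr_gt0.
by move=> x y; rewrite -{2}(gK x) -{2}(gK y) h mulKf// gt_eqF.
Qed.

Lemma similitude_id : similitude id 1.
Proof. by split=> // x y; rewrite mul1r. Qed.

Lemma similitude_comp f g s s' :
  similitude f s -> similitude g s' -> similitude (f \o g) (s * s').
Proof.
move=> [s0 hf] [s'0 hg]; split; first exact: mulr_gt0.
by move=> x y /=; rewrite hf hg mulrA.
Qed.

End Similitude.

(** * Distance to a set *)

Section Distance.
Variables (R : realType) (q : nat).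
Implicit Types (x y : 'rV[R]_q) (A B : set 'rV[R]_q).

Lemma dist_to_ge0 x A : 0 <= dist_to x A.
Proof.
have [->|/set0P A0] := eqVneq A set0; first by rewrite /dist_to image_set0 inf0.
by apply: lb_le_inf; [exact: image_nonempty|move=> _ [a _ <-]; exact: enorm_ge0].
Qed.

Lemma dist_to_le x A a : A a -> dist_to x A <= enorm (x - a).
Proof.
move=> Aa; apply: ge_inf; last by exists a.
by exists 0 => _ [b _ <-]; exact: enorm_ge0.
Qed.

Lemma le_dist_to x A c : A !=set0 -> (forall a, A a -> c <= enorm (x - a)) ->
  c <= dist_to x A.
Proof.
move=> A0 h; apply: lb_le_inf; first exact: image_nonempty.
by move=> _ [a Aa <-]; exact: h.
Qed.

Lemma dist_to_lt x A c : A !=set0 -> dist_to x A < c ->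
  exists2 a, A a & enorm (x - a) < c.
Proof.
move=> A0; apply: contraPP => h; apply/negP; rewrite -leNgt; apply: le_dist_to => //.
by move=> a Aa; rewrite leNgt; apply/negP => ?; apply: h; exists a.
Qed.

Lemma subset_dist_to x A B : A !=set0 -> A `<=` B -> dist_to x B <= dist_to x A.
Proof. by move=> A0 AB; apply: le_dist_to => // a /AB; exact: dist_to_le. Qed.

Lemma dist_to_triangle x y A : A !=set0 ->
  dist_to x A <= enorm (x - y) + dist_to y A.
Proof.
move=> A0; rewrite -lerBlDl; apply: le_dist_to => // a Aa; rewrite lerBlDl.
exact: le_trans (dist_to_le x Aa) (enorm_triangle _ _ _).
Qed.

(** A similitude commutes with distances, so that the cost of a piece of a
    self-similar measure is a rescaled cost of the whole. *)
Lemma dist_to_similitude f s x A : similitude f s -> A !=set0 ->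
  dist_to (f x) (f @` A) = s * dist_to x A.
Proof.
move=> [s0 h] A0; apply/eqP; rewrite eq_le; apply/andP; split.
  rewrite mulrC -ler_pdivrMr//; apply: le_dist_to => // a Aa.
  by rewrite ler_pdivrMr// mulrC -h; apply: dist_to_le; exists a.
apply: le_dist_to; first exact: image_nonempty.
by move=> _ [a Aa <-]; rewrite h ler_pM2l//; exact: dist_to_le.
Qed.

Lemma ball_enorm x e y : 0 < e -> enorm (x - y) < e -> ball x e y.
Proof.
by move=> e0 xy; rewrite -ball_normE/=; apply: le_lt_trans xy; exact: mx_norm_le_enorm.
Qed.

Lemma enorm_ball x e : 0 < e ->
  exists2 d, 0 < d & forall y, ball x d y -> enorm (x - y) < e.
Proof.
move=> e0; have q0 : 0 < q%:R + 1 :> R by rewrite ltr_wpDl.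
exists (e / (q%:R + 1)) => [|y]; first exact: divr_gt0.
rewrite -ball_normE/= ltr_pdivlMr// => /(le_lt_trans _); apply.
apply: le_trans (enorm_le_mx_norm _) _; rewrite mulrC.
by rewrite ler_wpM2l// lerDl.
Qed.

Lemma lipschitz_enorm_continuous (V : normedModType R) (phi : 'rV[R]_q -> V) L :
  (forall x y, `|phi x - phi y| <= L * enorm (x - y)) -> continuous phi.
Proof.
move=> h x; have FF : Filter (nbhs x) by exact: nbhs_filter.
apply/(@cvgrPdist_lt _ _ _ _ FF) => e e0.
have L0 : 0 < `|L| + 1 by rewrite ltr_wpDl.
have [d d0 hd] := @enorm_ball x (e / (`|L| + 1)) (divr_gt0 e0 L0).
apply/nbhs_ballP; exists d => //= y /hd.
rewrite ltr_pdivlMr// => /(le_lt_trans _); apply.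
apply: le_trans (h x y) _; rewrite mulrC ler_wpM2l ?enorm_ge0//.
by rewrite (le_trans (ler_norm _))// lerDl.
Qed.

Lemma dist_to_continuous A : A !=set0 -> continuous (fun x => dist_to x A).
Proof.
move=> A0; apply: (lipschitz_enorm_continuous (L := 1)) => x y; rewrite mul1r.
have := dist_to_triangle x y A0; have := dist_to_triangle y x A0.
by rewrite (enormB y x) ler_norml => h1 h2; apply/andP; split; lra.
Qed.

Lemma similitude_continuous (f : 'rV[R]_q -> 'rV[R]_q) s :
  similitude f s -> continuous f.
Proof.
move=> [s0 h]; apply: (lipschitz_enorm_continuous (L := s)) => x y.
by rewrite -h; exact: mx_norm_le_enorm.
Qed.

Lemma dist_to0_closure x A : A !=set0 -> dist_to x A = 0 -> closure A x.
Proof.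
move=> A0 d0 V /nbhs_ballP[e e0 eV].
have : dist_to x A < e by rewrite d0.
by move/(dist_to_lt A0) => [a Aa xa]; exists a; split=> //; apply: eV; exact: ball_enorm.
Qed.

Lemma open_dist_to_setC A x : open A -> A x -> ~` A !=set0 -> 0 < dist_to x (~` A).
Proof.
move=> oA Ax nA; rewrite lt_def dist_to_ge0 andbT; apply/eqP => /(dist_to0_closure nA).
by have /closure_id <- : closed (~` A) by exact: open_closedC.
Qed.

End Distance.

(** * Borel measures and quantization costs *)

Section BorelSets.
Variables (R : realType) (q : nat).

Lemma open_borel (A : set 'rV[R]_q) : open A -> measurable (A : set (borel R q)).
Proof. exact: sub_sigma_algebra. Qed.

Lemma closed_borel (A : set 'rV[R]_q) : closed A -> measurable (A : set (borel R q)).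
Proof.
move=> cA; have := @measurableC _ (borel R q) _ (open_borel (closed_openC cA)).
by rewrite setCK.
Qed.

Lemma continuous_borel_real (phi : 'rV[R]_q -> R) : continuous phi ->
  measurable_fun [set: borel R q] (phi : borel R q -> R).
Proof.
move=> /continuousP cphi; apply: (measurability _ (RGenOpens.measurableE R)).
move=> _ [_ [a [b ->] <-]]; rewrite setTI; apply: open_borel.
exact/cphi/interval_open.
Qed.

Lemma continuous_borel (f : 'rV[R]_q -> 'rV[R]_q) : continuous f ->
  measurable_fun [set: borel R q] (f : borel R q -> borel R q).
Proof.
move=> /continuousP cf.
apply: (@measurability _ _ (borel R q) (borel R q) setT f (@open 'rV[R]_q)) => //.
by move=> _ [A oA <-]; rewrite setTI; apply: open_borel; exact: cf.
Qed.

End BorelSets.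

(** Covers both kinds of measures: self-similar ones are the case [w0 = 0]. *)
Definition mixture (R : realType) (q N : nat) (f : 'I_N -> 'rV[R]_q -> 'rV[R]_q)
    (w0 : R) (w : 'I_N -> R) (Q P : probability (borel R q) R) : Prop :=
  forall A : set 'rV[R]_q, measurable (A : set (borel R q)) ->
    P A = (w0%:E * Q A + \sum_(i < N) (w i)%:E * P (f i @^-1` A))%E.

Section SelfSimilarIntegral.
Variables (R : realType) (q N : nat) (f : 'I_N -> 'rV[R]_q -> 'rV[R]_q).
Variables (w0 : R) (w : 'I_N -> R) (Q P : probability (borel R q) R).
Hypotheses (w0_ge0 : 0 <= w0) (w_ge0 : forall i, 0 <= w i).
Hypothesis f_cont : forall i, continuous (f i).
Hypothesis PE : mixture f w0 w Q P.

Let mf i : measurable_fun [set: borel R q] (f i : borel R q -> borel R q).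
Proof. exact: continuous_borel. Qed.

Let image i : {measure set (borel R q) -> \bar R} :=
  measure_function_pushforward__canonical__measure_function_Measure P (mf i).

Let m n : {measure set (borel R q) -> \bar R} :=
  if insub n is Some i then mscale (NngNum (w_ge0 i)) (image i)
  else mzero.

Let m0 : {measure set (borel R q) -> \bar R} := mscale (NngNum w0_ge0) Q.

(** The defining equation says that [P] coincides with a weighted sum of [Q]
    and of the images of [P]; an integral is linear in the measure. *)
Lemma self_similar_integral (phi : borel R q -> R) :
  measurable_fun [set: borel R q] phi -> (forall x, 0 <= phi x) ->
  (\int[P]_x (phi x)%:E = w0%:E * \int[Q]_x (phi x)%:E
     + \sum_(i < N) (w i)%:E * \int[P]_x (phi (f i x))%:E)%E.
Proof.
move=> /measurable_EFinP mphi phi0.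
rewrite (@eq_measure_integral _ _ _ _ (measure_add m0 (msum m N))); last first.
  move=> A mA _; apply: (etrans (PE mA)).
  apply/esym/(etrans (measure_addE m0 (msum m N) A)); congr (_ + _)%E.
  by apply: eq_bigr => i _; rewrite /m valK.
rewrite ge0_integral_measure_add//; last by move=> x _; rewrite lee_fin.
rewrite ge0_integral_mscale//; last by move=> x _; rewrite lee_fin.
congr (_ + _)%E; rewrite ge0_integral_measure_sum//; last first.
  by move=> x _; rewrite lee_fin.
apply: eq_bigr => i _; rewrite /m valK ge0_integral_mscale//; last first.
  by move=> x _; rewrite lee_fin.
by rewrite ge0_integral_pushforward//= => x _; rewrite lee_fin.
Qed.

End SelfSimilarIntegral.

(** The [r]-th power of the quantization error of [P] by the set [A].  It is
    locked because unification would otherwise unfold the integral. *)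
HB.lock
Definition cost (R : realType) (q : nat) (r : R) (P : probability (borel R q) R)
  (A : set 'rV[R]_q) : \bar R := (\int[P]_x (dist_to x A `^ r)%:E)%E.

Section Cost.
Variables (R : realType) (q : nat) (r : R).
Implicit Types (P Q : probability (borel R q) R) (A B : set 'rV[R]_q).
Hypothesis r0 : 0 < r.

Lemma measurable_dist_powR A : A !=set0 ->
  measurable_fun [set: borel R q] (fun x => dist_to x A `^ r).
Proof.
move=> A0; have md := continuous_borel_real (dist_to_continuous A0).
exact: measurableT_comp (measurable_powR r) md.
Qed.

Lemma measurable_cost_integrand A : A !=set0 ->
  measurable_fun [set: borel R q] (fun x => (dist_to x A `^ r)%:E).
Proof. by move=> A0; apply/measurable_EFinP; exact: measurable_dist_powR. Qed.

Lemma cost_ge0 P A : (0 <= cost r P A)%E.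
Proof. by rewrite cost.unlock; apply: integral_ge0 => x _; rewrite lee_fin powR_ge0. Qed.

Lemma subset_cost P A B : A !=set0 -> A `<=` B -> (cost r P B <= cost r P A)%E.
Proof.
move=> A0 AB; have B0 : B !=set0 by case: A0 => a /AB; exists a.
rewrite !cost.unlock; apply: ge0_le_integral => //; do ?exact: measurable_cost_integrand.
- by move=> x _; rewrite lee_fin powR_ge0.
- move=> x _; rewrite lee_fin; apply: ge0_ler_powR; rewrite ?nnegrE ?dist_to_ge0 ?(ltW r0)//.
  exact: subset_dist_to.
Qed.

Lemma cost_scale P A c : A !=set0 -> 0 <= c ->
  (\int[P]_x ((c * dist_to x A) `^ r)%:E = (c `^ r)%:E * cost r P A)%E.
Proof.
move=> A0 c0; rewrite cost.unlock -ge0_integralZl//; last 3 first.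
- exact: measurable_cost_integrand.
- by move=> x _; rewrite lee_fin powR_ge0.
- by rewrite lee_fin powR_ge0.
by apply: eq_integral => x _; rewrite powRM ?dist_to_ge0// EFinM.
Qed.

End Cost.

(** * Supports and invariant balls *)

Section Support.
Variables (R : realType) (q : nat).
Implicit Types (P Q : probability (borel R q) R) (X : set 'rV[R]_q).

Lemma msupportC_nbhs P x : ~ msupport P x ->
  exists V : set 'rV[R]_q, [/\ open V, V x & P V = 0%E].
Proof.
move=> /existsNP[V /not_implyP[oV /not_implyP[Vx PV]]]; exists V; split=> //.
by apply/eqP; rewrite eq_le measure_ge0 andbT leNgt; apply/negP.
Qed.

Lemma msupport_closed P : closed (msupport P).
Proof.
rewrite -openC.
rewrite (_ : ~` _ = \bigcup_(V in [set V : set 'rV[R]_q | open V /\ P V = 0%E]) V).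
  by apply: bigcup_open => V [].
apply/seteqP; split=> [x /msupportC_nbhs[V [oV Vx PV]]|x [V [oV PV] Vx] /= /(_ _ oV Vx)].
  by exists V.
by rewrite PV ltxx.
Qed.

Lemma rational_ball (x : 'rV[R]_q) (V : set 'rV[R]_q) : open V -> V x ->
  exists (c : 'rV[rat]_q) (e : rat),
    ball (map_mx ratr c : 'rV[R]_q) (ratr e) x /\
    ball (map_mx ratr c : 'rV[R]_q) (ratr e) `<=` V.
Proof.
rewrite openE => /[apply] /nbhs_ballP[d /= d0 dV].
have [e] := rat_in_itvoo (divr_gt0 d0 (ltr0n _ 2)); rewrite in_itv/= => /andP[e0 ed].
have h (i : 'I_q) : exists a : rat, `|x 0 i - ratr a| < ratr e.
  have [a] := @rat_in_itvoo R (x 0 i - ratr e) (x 0 i + ratr e) ltac:(lra).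
  by rewrite in_itv/= => /andP[h1 h2]; exists a; rewrite ltr_norml; apply/andP; split; lra.
have [a ha] := choice h; exists (\row_i a i), e.
have cx : `|x - map_mx ratr (\row_i a i)| < ratr e.
  rewrite [ltLHS]/Num.Def.normr /= mx_normrE.
  by apply: bigmax_lt => // -[i j] _ /=; rewrite ord1 !mxE.
rewrite -ball_normE/=; split; first by rewrite -normrN opprB.
move=> y /= cy; apply: dV; rewrite -ball_normE/=.
rewrite -(subrK (map_mx ratr (\row_i a i)) x) -addrA.
by apply: le_lt_trans (ler_normD _ _) _; rewrite ltr_pdivlMr// in ed; lra.
Qed.

(** The complement of the support is covered by the countably many null balls
    with rational centre and radius. *)
Lemma msupport_null P : P (~` msupport P) = 0%E.
Proof.
pose B (ce : 'rV[rat]_q * rat) : set 'rV[R]_q :=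
  ball (map_mx ratr ce.1 : 'rV[R]_q) (ratr ce.2).
pose F n := if @unpickle ('rV[rat]_q * rat)%type n is Some ce
            then if P (B ce) == 0%E then B ce else set0 else set0.
have mB ce : measurable (B ce : set (borel R q)).
  by apply: open_borel; exact: ball_open.
have nF : P.-negligible (\bigcup_n (F n : set (borel R q))).
  apply: negligible_bigcup => n; rewrite /F; case: unpickle => [ce|]; last first.
    exact: negligible_set0.
  case: ifPn => [/eqP Pce|_]; last exact: negligible_set0.
  by apply/negligibleP.
apply: measure_negligible.
  by apply: open_borel; rewrite openC; exact: msupport_closed.
apply: negligibleS nF => x /msupportC_nbhs[V [oV Vx PV]].
have [c [e [cx cV]]] := rational_ball oV Vx; exists (pickle (c, e)) => //.
rewrite /F pickleK; case: ifPn => // /negP[].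
rewrite eq_le measure_ge0 andbT -PV; apply: le_measure; rewrite ?inE//.
exact: open_borel.
Qed.

(** Comparisons are only available on a set [X] of full measure: a large ball,
    or the support. *)
Lemma le_integral_null P X (phi psi : borel R q -> R) :
  measurable (X : set (borel R q)) -> P (~` X) = 0%E ->
  measurable_fun [set: borel R q] phi -> measurable_fun [set: borel R q] psi ->
  (forall x, 0 <= phi x) -> (forall x, 0 <= psi x) ->
  (forall x, X x -> phi x <= psi x) ->
  (\int[P]_x (phi x)%:E <= \int[P]_x (psi x)%:E)%E.
Proof.
move=> mX PX /measurable_EFinP mphi /measurable_EFinP mpsi phi0 psi0 le.
apply: ae_ge0_le_integral => //; do ?by move=> x _; rewrite lee_fin.
have nX : P.-negligible (~` X : set (borel R q)).
  by apply/negligibleP => //; exact: measurableC.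
apply: negligibleS nX => x /=; apply: contra_not => /le h _.
by rewrite lee_fin.
Qed.

Let integral_cst_probability P k : (\int[P]_x (cst k x)%:E = k%:E)%E.
Proof.
rewrite (integral_cst P measurableT k%:E) -[RHS]mule1; congr (_ * _)%E.
exact: probability_setT.
Qed.

Lemma cst_le_integral_null P X (phi : borel R q -> R) k :
  measurable (X : set (borel R q)) -> P (~` X) = 0%E ->
  measurable_fun [set: borel R q] phi -> (forall x, 0 <= phi x) -> 0 <= k ->
  (forall x, X x -> k <= phi x) -> (k%:E <= \int[P]_x (phi x)%:E)%E.
Proof.
move=> mX PX mphi phi0 k0 le; rewrite -(integral_cst_probability P k).
exact: (le_integral_null mX PX (measurable_cst k) mphi (fun=> k0) phi0 le).
Qed.

Lemma integral_le_cst_null P X (phi : borel R q -> R) k :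
  measurable (X : set (borel R q)) -> P (~` X) = 0%E ->
  measurable_fun [set: borel R q] phi -> (forall x, 0 <= phi x) -> 0 <= k ->
  (forall x, X x -> phi x <= k) -> (\int[P]_x (phi x)%:E <= k%:E)%E.
Proof.
move=> mX PX mphi phi0 k0 le; rewrite -(integral_cst_probability P k).
exact: (le_integral_null mX PX mphi (measurable_cst k) phi0 (fun=> k0) le).
Qed.

Definition cball rho : set 'rV[R]_q := [set x | enorm x <= rho].

Lemma cball_closed rho : closed (cball rho).
Proof.
have c : continuous (@enorm R q).
  apply: (lipschitz_enorm_continuous (L := 1)) => x y; rewrite mul1r.
  have := enormD (x - y) y; have := enormD (y - x) x; rewrite !subrK (enormB y x).
  by move=> h1 h2; rewrite ler_norml; apply/andP; split; lra.
exact: (@closed_comp _ _ (@enorm R q) [set x | x <= rho] (fun x _ => c x) (@closed_le _ rho)).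
Qed.

Lemma finite_upper_bound n (b : 'I_n -> R) : exists B, forall i, b i <= B.
Proof.
exists (\sum_i `|b i|) => i; apply: le_trans (ler_norm _) _.
by rewrite (bigD1 i)//= lerDl sumr_ge0.
Qed.

(** [enorm (f i 0) + s i * rho <= rho] as soon as [enorm (f i 0) / (1 - s i) <= rho]. *)
Lemma cball_stable n (f : 'I_n -> 'rV[R]_q -> 'rV[R]_q) (s : 'I_n -> R) :
  (forall i, contractive_similitude (f i) (s i)) ->
  exists rho0, forall rho, rho0 <= rho -> forall i x, cball rho x -> cball rho (f i x).
Proof.
move=> hf; have [B hB] := finite_upper_bound (fun i => enorm (f i 0) / (1 - s i)).
exists B => rho Brho i x; rewrite /cball/= => xrho.
have [/andP[s0 s1] fE] := hf i.
have /le_trans/(_ Brho) := hB i; rewrite ler_pdivrMr ?subr_gt0// => h.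
have := enormD (f i x - f i 0) (f i 0); rewrite subrK fE subr0.
have : s i * enorm x <= s i * rho by rewrite ler_pM2l.
lra.
Qed.

Lemma compact_cball (C : set 'rV[R]_q) : compact C ->
  exists rho0, forall rho, rho0 <= rho -> C `<=` cball rho.
Proof.
move=> /compact_bounded[M [_ hM]]; exists (q%:R * (M + 1)) => rho le x Cx.
apply: le_trans (enorm_le_mx_norm _) (le_trans _ le).
by rewrite ler_wpM2l//; apply: hM => //; rewrite ltrDl.
Qed.

(** With [X] stable, the mass of the complement of [X] is reproduced with a
    factor [\sum_i w i < 1], hence vanishes. *)
Lemma self_similar_null n (f : 'I_n -> 'rV[R]_q -> 'rV[R]_q) (w0 : R) (w : 'I_n -> R)
    Q P X :
  (forall i, continuous (f i)) -> (forall i, 0 <= w i) -> \sum_i w i < 1 ->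
  mixture f w0 w Q P ->
  measurable (X : set (borel R q)) -> (forall i x, X x -> X (f i x)) ->
  Q (~` X) = 0%E -> P (~` X) = 0%E.
Proof.
move=> fc w_ge0 w1 PE mX fX QX.
have mXC : measurable (~` X : set (borel R q)) by exact: measurableC.
have := PE _ mXC; rewrite QX mule0 add0e.
have Pfin : P (~` X) \is a fin_num by rewrite fin_num_measure.
have le : (\sum_(i < n) (w i)%:E * P (f i @^-1` (~` X)) <=
           \sum_(i < n) (w i)%:E * P (~` X))%E.
  apply: lee_sum => i _; apply: lee_wpmul2l; first by rewrite lee_fin.
  apply: le_measure; rewrite ?inE//.
    by have := continuous_borel (fc i) measurableT mXC; rewrite setTI.
  by move=> x /=; apply: contra_not; exact: fX.
move=> PXE; rewrite -PXE in le.
(* [P] is finite, hence the equation may be read in [R]. *)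
have PXp : P (~` X) = (fine (P (~` X)))%:E by rewrite fineK.
set p := fine _ in PXp.
have p0 : 0 <= p by rewrite -lee_fin -PXp.
have {}le : p <= (\sum_i w i) * p.
  rewrite -lee_fin -PXp (le_trans le)// PXp mulr_suml -sumEFin.
  by apply: lee_sum => i _; rewrite EFinM.
rewrite PXp; congr EFin; apply/eqP; rewrite eq_le p0 andbT.
have : 0 <= (\sum_i w i - 1) * p by lra.
by rewrite nmulr_rge0// subr_lt0.
Qed.

End Support.

(** * One generation of the recursion *)

Section FiniteFamilies.
Variables (R : realType) (n : nat).

(** A product of numbers of [[0, 1]] is below each of its factors. *)
Lemma finite_bounds01 (h : 'I_n -> R) : (forall i, 0 < h i < 1) ->
  exists hm th : R, [/\ 0 < hm <= 1, 0 < th < 1 & forall i, hm <= h i <= th].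
Proof.
have prod_le (g : 'I_n -> R) i : (forall j, 0 < g j < 1) -> 0 < \prod_j g j <= g i.
  move=> g01; have g0 j : 0 < g j by have /andP[] := g01 j.
  rewrite prodr_gt0//= (bigD1 i)//= ler_piMr ?(ltW (g0 i))//.
  by apply: prodr_ile1 => j _; have /andP[/ltW-> /ltW->] := g01 j.
move=> h01; exists (\prod_i h i), (Num.max 2^-1 (1 - \prod_i (1 - h i))); split.
- apply/andP; split; first by apply: prodr_gt0 => i _; have /andP[] := h01 i.
  by apply: prodr_ile1 => j _; have /andP[/ltW-> /ltW->] := h01 j.
- rewrite lt_max invr_gt0 ltr0n/= gt_max invf_lt1 ?ltr1n//= ltrBlDr ltrDl.
  by apply: prodr_gt0 => i _; rewrite subr_gt0; have /andP[] := h01 i.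
- move=> i; have /andP[_ ->] := prod_le h i h01; rewrite /= le_max; apply/orP; right.
  have h01' j : 0 < 1 - h j < 1 by have /andP[? ?] := h01 j; apply/andP; split; lra.
  by have /andP[_] := prod_le (fun i => 1 - h i) i h01'; lra.
Qed.

End FiniteFamilies.

Section Recursion.
Variables (R : realType) (q N : nat) (f : 'I_N -> 'rV[R]_q -> 'rV[R]_q).
Variables (s : 'I_N -> R) (w0 : R) (w : 'I_N -> R).
Variables (Q P : probability (borel R q) R) (r : R).
Hypothesis f_sim : forall i, contractive_similitude (f i) (s i).
Hypotheses (w0_ge0 : 0 <= w0) (w_gt0 : forall i, 0 < w i) (r0 : 0 < r).
Hypothesis PE : mixture f w0 w Q P.

Let sim i : similitude (f i) (s i) := contractive_similitudeW (f_sim i).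
Let s0 i : 0 < s i := (sim i).1.
Let h i := w i * s i `^ r.

Lemma cost_rec A : A !=set0 ->
  cost r P A = (w0%:E * cost r Q A
    + \sum_(i < N) (w i)%:E * \int[P]_x (dist_to (f i x) A `^ r)%:E)%E.
Proof.
move=> A0; rewrite !cost.unlock.
exact: (self_similar_integral w0_ge0 (fun i => ltW (w_gt0 i))
  (fun i => similitude_continuous (sim i)) PE (measurable_dist_powR r A0)
  (fun x => powR_ge0 _ _)).
Qed.

Let measurable_pull A i : A !=set0 ->
  measurable_fun [set: borel R q] (fun x => dist_to (f i x) A `^ r).
Proof.
move=> A0; have mf := continuous_borel (similitude_continuous (sim i)).
exact: (measurableT_comp (measurable_dist_powR r A0) mf).
Qed.

Let cost_image i A : A !=set0 ->
  (\int[P]_x (dist_to (f i x) (f i @` A) `^ r)%:E = (s i `^ r)%:E * cost r P A)%E.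
Proof.
move=> A0; rewrite -(cost_scale r P A0 (ltW (s0 i))); apply: eq_integral => x _.
by rewrite (dist_to_similitude _ (sim i)).
Qed.

Let le_cost_pull i A B : A !=set0 -> A `<=` B ->
  (\int[P]_x (dist_to (f i x) B `^ r)%:E <= \int[P]_x (dist_to (f i x) A `^ r)%:E)%E.
Proof.
move=> A0 AB; have B0 : B !=set0 by case: A0 => a /AB; exists a.
apply: ge0_le_integral => //; do ?by [move=> x _; rewrite lee_fin powR_ge0
  |apply/measurable_EFinP; exact: measurable_pull].
move=> x _; rewrite lee_fin; apply: ge0_ler_powR; rewrite ?nnegrE ?dist_to_ge0 ?(ltW r0)//.
exact: subset_dist_to.
Qed.

(** Near the [i]-th piece it is enough to use the points [f i @` B i], which
    serve that piece as [B i] serves the whole measure, up to [s i `^ r]. *)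
Lemma cost_rec_le A A0 (B : 'I_N -> set 'rV[R]_q) : A !=set0 ->
  (w0 = 0 \/ A0 !=set0 /\ A0 `<=` A) ->
  (forall i, B i !=set0) -> (forall i, f i @` B i `<=` A) ->
  (cost r P A <= w0%:E * cost r Q A0 + \sum_(i < N) (h i)%:E * cost r P (B i))%E.
Proof.
move=> Ane A0A Bne BA; rewrite (cost_rec Ane); apply: leeD.
  case: A0A => [->|[A00 A0A]].
    by rewrite !mul0e.
  apply: lee_wpmul2l; first by rewrite lee_fin.
  exact: subset_cost.
apply: lee_sum => i _; rewrite EFinM -muleA -(cost_image i (Bne i)).
apply: lee_wpmul2l; first by rewrite lee_fin ltW.
by apply: le_cost_pull => //; exact: image_nonempty.
Qed.

(** The counterpart for lower bounds: pulling [A] back by [f i] gives at best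
    the approximating set [B i] for the [i]-th copy of [P]. *)
Lemma cost_rec_ge A (B : 'I_N -> set 'rV[R]_q) : A !=set0 ->
  (forall i, B i !=set0) -> (forall i, A `<=` f i @` B i) ->
  (w0%:E * cost r Q A + \sum_(i < N) (h i)%:E * cost r P (B i) <= cost r P A)%E.
Proof.
move=> Ane Bne AB; rewrite [leRHS](cost_rec Ane); apply: leeD; first exact: lexx.
apply: lee_sum => i _; rewrite EFinM -muleA -(cost_image i (Bne i)).
by apply: lee_wpmul2l; [rewrite lee_fin ltW|exact: le_cost_pull].
Qed.

End Recursion.

(** * Upper recursion *)

Section PowerSums.
Variables (R : realType) (n : nat) (h : 'I_n -> R) (kap x : R).
Hypotheses (h_gt0 : forall i, 0 < h i) (x0 : 0 < x) (kap0 : 0 < kap).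
Hypothesis h1 : \sum_i h i `^ kap = 1.

(** The next three identities say that the three shapes of bounds used below,
    [x `^ kap] for numbers of points, [x `^ (kap - 1)] for errors and
    [(k * x `^ kap - n) / x] for lower bounds, are reproduced exactly when the
    budget [x] is replaced by [x * h i] in the [i]-th piece. *)
Lemma sum_powRM c : \sum_i c * (x * h i) `^ kap = c * x `^ kap.
Proof.
rewrite -mulr_sumr; congr (_ * _); rewrite -[RHS]mulr1 -h1 mulr_sumr.
by apply: eq_bigr => i _; rewrite powRM ?ltW.
Qed.

Lemma sum_mul_powRB1 c : \sum_i h i * (c * (x * h i) `^ (kap - 1)) = c * x `^ (kap - 1).
Proof.
rewrite -[RHS]mulr1 -[X in _ = _ * X]h1 mulr_sumr; apply: eq_bigr => i _.
by rewrite powRM ?(ltW x0) ?(ltW (h_gt0 i))// -(mulr_powRB1 (ltW (h_gt0 i)) kap0); ring.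
Qed.

Lemma sum_linear c k (m : 'I_n -> R) :
  \sum_i h i * (c * (k * (x * h i) `^ kap - m i) / (x * h i)) =
  c * (k * x `^ kap - \sum_i m i) / x.
Proof.
transitivity (\sum_i (c / x * k * (x * h i) `^ kap - c / x * m i)).
  apply: eq_bigr => i _; field.
  by rewrite !gt_eqF.
rewrite sumrB sum_powRM -mulr_sumr; ring.
Qed.

Lemma index_inhabited : exists i : 'I_n, true.
Proof.
have : \sum_i h i `^ kap != 0 by rewrite h1 oner_eq0.
case: n h => [h'|m h' _]; last by exists ord0.
by rewrite big_ord0 eqxx.
Qed.

End PowerSums.

Lemma le_exprn (R : realType) (y x : R) (k : nat) :
  1 < y -> 0 < x -> ln x / ln y <= k%:R -> x <= y ^+ k.
Proof.
move=> y1 x0; have y0 : 0 < y by exact: lt_trans y1.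
rewrite ler_pdivrMr ?ln_gt0// => h.
rewrite -ler_ln ?posrE ?exprn_gt0// lnXn// -mulr_natl; exact: h.
Qed.

Lemma le_exprn_exists (R : realType) (y x : R) : 1 < y -> exists k : nat, x <= y ^+ k.
Proof.
move=> y1; have [x0|x0] := ltP 0 x; last by exists 0%N; rewrite expr0 (le_trans x0).
exists (Num.bound `|ln x / ln y|); apply: le_exprn => //.
by rewrite (le_trans (ler_norm _))// ltW// archi_boundP.
Qed.

Lemma size_flatten_enum (T : Type) n (b : 'I_n -> seq T) :
  size (flatten [seq b i | i <- enum 'I_n]) = (\sum_i size (b i))%N.
Proof. by rewrite size_flatten /shape sumnE -map_comp big_map big_enum. Qed.

Section UpperRecursion.
Variables (R : realType) (q N : nat) (f : 'I_N -> 'rV[R]_q -> 'rV[R]_q).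
Variables (s : 'I_N -> R) (w0 : R) (w : 'I_N -> R).
Variables (Q P : probability (borel R q) R) (r : R).
Hypothesis f_sim : forall i, contractive_similitude (f i) (s i).
Hypotheses (w0_ge0 : 0 <= w0) (w_gt0 : forall i, 0 < w i) (r0 : 0 < r).
Hypothesis PE : mixture f w0 w Q P.

Let h i := w i * s i `^ r.

Variables (kap hm th rho : R).
Hypotheses (kap0 : 0 < kap) (kap1 : kap < 1) (h1 : \sum_i h i `^ kap = 1).
Hypotheses (hm01 : 0 < hm <= 1) (th01 : 0 < th < 1) (hb : forall i, hm <= h i <= th).
Hypothesis Prho : P (~` @cball R q rho) = 0%E.

Let h_gt0 i : 0 < h i.
Proof. by have /andP[/(lt_le_trans (andP hm01).1)] := hb i. Qed.

(** Almost every point is at distance at most [rho] from the origin. *)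
Lemma cost_origin : (cost r P [set (0%R : 'rV[R]_q)] <= (rho `^ r)%:E)%E.
Proof.
rewrite cost.unlock; apply: (integral_le_cst_null _ Prho).
- by apply: closed_borel; exact: cball_closed.
- by apply: measurable_dist_powR; exists 0.
- by move=> x; exact: powR_ge0.
- exact: powR_ge0.
- move=> x xrho; have d := @dist_to_le R q x [set 0] 0 erefl.
  rewrite subr0 in d; apply: ge0_ler_powR; rewrite ?nnegrE ?dist_to_ge0 ?(ltW r0)//.
    exact: le_trans (enorm_ge0 x) xrho.
  exact: le_trans d xrho.
Qed.

Variables (A B D : R).
Hypotheses (Ahm : 1 <= A * hm) (rB : rho `^ r <= B) (D0 : 0 <= D).
Hypothesis base : forall x, 1 <= x -> exists a : seq 'rV[R]_q,
  [/\ w0 = 0 \/ a != [::], (size a)%:R <= D * A * x `^ kap &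
      (w0%:E * cost r Q [set` a] <= (D * B * x `^ (kap - 1))%:E)%E].

(** A budget [x > 1] is passed on to the pieces as [x * h i], until it drops
    below [1]; [k] bounds the number of generations.  Each generation adds the
    share [D] needed for the term [w0 * Q], hence the factor [1 + D * k];
    self-similar measures correspond to [D = 0]. *)
Lemma upper_recursion k x : hm <= x -> x <= th^-1 ^+ k ->
  exists a : seq 'rV[R]_q, [/\ a != [::],
    (size a)%:R <= (1 + D * k%:R) * A * x `^ kap &
    (cost r P [set` a] <= ((1 + D * k%:R) * B * x `^ (kap - 1))%:E)%E].
Proof.
have [hm0 hmle1] := andP hm01; have [th0 th1] := andP th01.
have A0 : 0 < A by rewrite -(pmulr_lgt0 _ hm0) (lt_le_trans ltr01).
have B0 : 0 <= B by exact: le_trans (powR_ge0 _ _) rB.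
have Dk m : 1 <= 1 + D * m%:R by rewrite lerDl mulr_ge0.
(* A budget below [1] is served by a single point. *)
have small m y : hm <= y -> y <= 1 -> exists a : seq 'rV[R]_q, [/\ a != [::],
    (size a)%:R <= (1 + D * m%:R) * A * y `^ kap &
    (cost r P [set` a] <= ((1 + D * m%:R) * B * y `^ (kap - 1))%:E)%E].
  move=> hmy y1; have y0 : 0 < y := lt_le_trans hm0 hmy.
  have y01 : 0 < y <= 1 by rewrite y0.
  exists [:: 0]; split=> //=.
    apply: (le_trans Ahm); rewrite -[leLHS]mul1r -mulrA.
    apply: ler_pM; rewrite ?mulr_ge0 ?(ltW A0) ?(ltW hm0)//.
    rewrite ler_wpM2l ?(ltW A0)//; apply: le_trans hmy _.
    by rewrite -{1}(powRr1 (ltW y0)); apply: ger_powR; rewrite // ltW.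
  rewrite set_cons1; apply: le_trans cost_origin _; rewrite lee_fin.
  apply: le_trans rB _; rewrite -[leLHS]mulr1 -[B in leLHS]mul1r.
  apply: ler_pM; rewrite ?mulr_ge0 ?ler_wpM2r//.
  by rewrite -[leLHS](powRr0 y); apply: ger_powR; rewrite // subr_le0 ltW.
elim: k x => [|k IH] x hmx xth; first by apply: small; rewrite // -(expr0 th^-1).
have [x1|x1] := leP x 1; first exact: small.
have x0 : 0 < x by exact: lt_trans x1.
have [a0 [a0ne sa0 ca0]] := base (ltW x1).
have xh i : exists b : seq 'rV[R]_q, [/\ b != [::],
    (size b)%:R <= (1 + D * k%:R) * A * (x * h i) `^ kap &
    (cost r P [set` b] <= ((1 + D * k%:R) * B * (x * h i) `^ (kap - 1))%:E)%E].
  have [h_hm h_th] := andP (hb i); apply: IH.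
    by apply: le_trans h_hm _; rewrite ler_peMl ?(ltW (h_gt0 i))// ltW.
  apply: (@le_trans _ _ (th^-1 ^+ k.+1 * th)).
    by rewrite ler_pM// ?(ltW x0) ?(ltW (h_gt0 i)).
  by rewrite exprSr mulfVK// gt_eqF.
have [b hb'] := choice xh.
pose a := a0 ++ flatten [seq map (f i) (b i) | i <- enum 'I_N].
have ba i y : y \in b i -> f i y \in a.
  move=> yb; rewrite mem_cat; apply/orP; right; apply/flatten_mapP.
  by exists i; rewrite ?mem_enum//; apply/mapP; exists y.
have bne i : [set` b i] !=set0.
  have [+ _ _] := hb' i; case: (b i) => // y l _; exists y.
  by rewrite /= inE eqxx.
have ane : [set` a] !=set0.
  have [i _] := index_inhabited h1; have [y yb] := bne i.
  by exists (f i y); exact: ba.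
exists a; split.
- by case: (a) ane => // -[y]; rewrite /= in_nil.
- rewrite size_cat size_flatten_enum natrD natr_sum.
  rewrite (_ : (1 + D * k.+1%:R) = D + (1 + D * k%:R)); last by rewrite -natr1; ring.
  rewrite 2!mulrDl; apply: lerD => //.
  rewrite -(sum_powRM h_gt0 x0 h1); apply: ler_sum => i _; rewrite size_map.
  by have [] := hb' i.
- rewrite (_ : (1 + D * k.+1%:R) = D + (1 + D * k%:R)); last by rewrite -natr1; ring.
  rewrite 2!mulrDl EFinD.
  apply: le_trans (cost_rec_le (A0 := [set` a0]) f_sim w0_ge0 w_gt0 r0 PE ane _ bne _) _.
  + case: a0ne => [|a0ne]; [by left|right; split].
      by case: (a0) a0ne => // y l _; exists y; rewrite /= inE eqxx.
    by move=> y /= ya; rewrite mem_cat ya.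
  + by move=> i _ /= [y yb <-]; exact: ba.
  apply: leeD => //; rewrite -(sum_mul_powRB1 h_gt0 x0 kap0 h1) -sumEFin.
  apply: lee_sum => i _; rewrite [leRHS]EFinM; apply: lee_wpmul2l.
    by rewrite lee_fin; exact: ltW (h_gt0 i).
  by have [] := hb' i.
Qed.

End UpperRecursion.

(** * Lower recursion *)

(** Adding the complement of [U] makes points outside [U] useless: a lower bound
    for the cost of a barrier holds however many of them are used. *)
Definition barrier (R : realType) (q : nat) (U : set 'rV[R]_q) (a : seq 'rV[R]_q) :
  set 'rV[R]_q := [set` a] `|` ~` U.

Section LowerRecursion.
Variables (R : realType) (q N : nat) (f : 'I_N -> 'rV[R]_q -> 'rV[R]_q).
Variables (s : 'I_N -> R) (w0 : R) (w : 'I_N -> R).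
Variables (Q P : probability (borel R q) R) (r : R) (U : set 'rV[R]_q).
Hypothesis f_sim : forall i, contractive_similitude (f i) (s i).
Hypotheses (w0_ge0 : 0 <= w0) (w_gt0 : forall i, 0 < w i) (r0 : 0 < r).
Hypothesis PE : mixture f w0 w Q P.
Hypotheses (fU : \bigcup_i (f i @` U) `<=` U) (tU : trivIset setT (fun i => f i @` U)).
Hypothesis UC : ~` U !=set0.

Let h i := w i * s i `^ r.

Let sim i : similitude (f i) (s i) := contractive_similitudeW (f_sim i).

Let h_gt0 i : 0 < h i.
Proof. by rewrite mulr_gt0// powR_gt0// (sim i).1. Qed.

Lemma barrier_nonempty a : barrier U a !=set0.
Proof. by case: UC => x Ux; exists x; right. Qed.

(** As the pieces of [U] are disjoint, each point of [a] is useful for at most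
    one of them: for the [i]-th piece, the other points are hidden behind the
    complement of [f i @` U].  Points in no piece at all are collected in
    [a0]. *)
Lemma pull_points (a : seq 'rV[R]_q) :
  exists (a0 : seq 'rV[R]_q) (b : 'I_N -> seq 'rV[R]_q),
  [/\ (size a0 + \sum_i size (b i) <= size a)%N,
      forall x, x \in a -> (forall i, ~ (f i @` U) x) -> x \in a0 &
      forall i, barrier U a `<=` f i @` barrier U (b i)].
Proof.
have [g /all_and2[gs gK]] : {g : 'I_N -> 'rV[R]_q -> 'rV[R]_q &
    forall i, similitude (g i) (s i)^-1 /\ (cancel (g i) (f i) /\ cancel (f i) (g i))}.
  have inv i : exists g, similitude g (s i)^-1 /\ (cancel g (f i) /\ cancel (f i) g).
    by have [g gs gK] := similitude_inv (sim i); exists g.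
  by exists (fun i => projT1 (cid (inv i))) => i; case: cid.
have gU i x : U (g i x) <-> (f i @` U) x.
  split=> [Ug|[y Uy <-]]; first by exists (g i x) => //; rewrite (gK i).1.
  by rewrite (gK i).2.
pose p i : pred 'rV[R]_q := fun x => `[< U (g i x) >].
pose p0 : pred 'rV[R]_q := fun x => [forall i, ~~ p i x].
exists [seq x <- a | p0 x], (fun i => [seq y <- map (g i) a | `[< U y >]]); split.
- under eq_bigr do rewrite size_filter count_map.
  rewrite size_filter; elim: a => [|x a IH] /=; first by rewrite big1.
  rewrite big_split/= addnACA -[(size a).+1]add1n leq_add//.
  have [/existsP[i pix]|] := boolP [exists i, p i x]; last first.
    rewrite negb_exists => /forallP px; rewrite big1 ?addn0 ?leq_b1// => i _.
    by apply/eqP; rewrite eqb0; exact: px.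
  rewrite (_ : p0 x = false) ?add0n; last by apply/negP => /forallP/(_ i); rewrite pix.
  rewrite (bigD1 i)//= big1 ?addn0 ?leq_b1// => j ji; apply/eqP; rewrite eqb0.
  apply: contra ji => /asboolP/gU fj; move: pix => /asboolP/gU fi.
  by apply/eqP; apply: tU => //; exists x.
- move=> x xa nx; rewrite mem_filter xa andbT; apply/forallP => i.
  by apply/negP => /asboolP/gU; exact: nx.
- move=> i x ax; exists (g i x); last by rewrite (gK i).1.
  have [Ug|] := pselect (U (g i x)); last by right.
  left; rewrite /= mem_filter; apply/andP; split; first exact/asboolP.
  apply: map_f; case: ax => // nUx; exfalso; apply: nUx.
  by apply: fU; exists i => //; exact/gU.
Qed.

Lemma lower_step (a : seq 'rV[R]_q) :
  exists (a0 : seq 'rV[R]_q) (b : 'I_N -> seq 'rV[R]_q),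
  [/\ (size a0 + \sum_i size (b i) <= size a)%N,
      forall x, x \in a -> (forall i, ~ (f i @` U) x) -> x \in a0 &
      forall v0 (v : 'I_N -> R),
        (v0%:E <= w0%:E * cost r Q (barrier U a))%E ->
        (forall i, ((v i)%:E <= cost r P (barrier U (b i)))%E) ->
        ((v0 + \sum_i h i * v i)%:E <= cost r P (barrier U a))%E].
Proof.
have [a0 [b [sz ha0 hb]]] := pull_points a; exists a0, b; split=> // v0 v hv0 hv.
have := cost_rec_ge f_sim w0_ge0 w_gt0 r0 PE (barrier_nonempty a)
  (fun i => barrier_nonempty (b i)) hb.
apply: le_trans; rewrite EFinD -sumEFin; apply: leeD => //.
apply: lee_sum => i _; rewrite [leLHS]EFinM; apply: lee_wpmul2l => //.
by rewrite lee_fin; exact: ltW (h_gt0 i).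
Qed.

Variables (kap hm : R).
Hypotheses (kap0 : 0 < kap) (h1 : \sum_i h i `^ kap = 1).
Hypotheses (hm01 : 0 < hm <= 1) (hb : forall i, hm <= h i).

Let hm0 : 0 < hm. Proof. by case/andP: hm01. Qed.

Let ler_count (c x y : R) (a : seq 'rV[R]_q) (m : nat) : 0 <= c -> 0 < x -> (m <= size a)%N ->
  c * (y - (size a)%:R) / x <= c * (y - m%:R) / x.
Proof.
move=> c0 x0 ma; rewrite ler_pM2r ?invr_gt0// ler_wpM2l// lerD2l lerN2.
by rewrite ler_nat.
Qed.

(** A lower bound that is linear in the number of points goes through the
    recursion whatever the distribution of the points among the pieces, since
    only the sum of their numbers matters.  When [x <= 1] the right-hand side is
    positive only if there are no points, and [c0] takes care of that case. *)
Lemma lower_self_similar th c0 k x a : w0 = 0 -> 0 < th < 1 -> (forall i, h i <= th) ->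
  0 <= c0 -> (c0%:E <= cost r P (~` U))%E -> hm <= x -> x <= th^-1 ^+ k ->
  ((c0 * hm * (x `^ kap - (size a)%:R) / x)%:E <= cost r P (barrier U a))%E.
Proof.
move=> w00 /andP[th0 th1] hth c00 hc0.
have c1 : 0 <= c0 * hm by rewrite mulr_ge0 ?(ltW hm0).
have small y b : hm <= y -> y <= 1 ->
  ((c0 * hm * (y `^ kap - (size b)%:R) / y)%:E <= cost r P (barrier U b))%E.
  move=> hmy y1; have y0 : 0 < y := lt_le_trans hm0 hmy.
  have yk1 : y `^ kap <= 1 by rewrite -(powRr0 y) ger_powR ?y0//= ltW.
  case: b => [|z b].
    rewrite /barrier set_nil set0U; apply: le_trans hc0.
    rewrite lee_fin subr0 ler_pdivrMr// -mulrA ler_wpM2l// -[leRHS]mulr1.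
    by rewrite ler_pM ?powR_ge0// ltW.
  apply: le_trans (cost_ge0 _ _ _); rewrite lee_fin pmulr_lle0 ?invr_gt0//.
  apply: mulr_ge0_le0 => //; rewrite subr_le0 (le_trans yk1)//.
  by rewrite ler1n.
elim: k x a => [|k IH] x a hmx xth; first exact: small.
have [x1|x1] := leP x 1; first exact: small.
have x0 : 0 < x by exact: lt_trans x1.
have [a0 [b [sz _ step]]] := lower_step a.
have xh i : hm <= x * h i /\ x * h i <= th^-1 ^+ k.
  split; first by apply: le_trans (hb i) _; rewrite ler_peMl ?(ltW (h_gt0 i))// ltW.
  apply: (@le_trans _ _ (th^-1 ^+ k.+1 * th)).
    by rewrite ler_pM// ?(ltW x0) ?(ltW (h_gt0 i)).
  by rewrite exprSr mulfVK// gt_eqF.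
have v0 : (0%:E <= w0%:E * cost r Q (barrier U a))%E by rewrite w00 mul0e.
have := step 0 _ v0 (fun i => IH _ (b i) (xh i).1 (xh i).2).
apply: le_trans; rewrite lee_fin add0r.
under eq_bigr do rewrite -[_ `^ kap]mul1r.
rewrite sum_linear// mul1r -natr_sum; apply: ler_count => //.
exact: leq_trans (leq_addl _ _) sz.
Qed.

Section Mixture.
Variable c : R.
Hypothesis c_ge0 : 0 <= c.

Let hmVX k x i : hm^-1 ^+ k.+1 <= x -> [/\ 0 < x, 1 <= x & hm^-1 ^+ k <= x * h i].
Proof.
move=> hx.
have hmV1 : 1 <= hm^-1 by rewrite invf_ge1//; case/andP: hm01.
have x1 : 1 <= x by rewrite (le_trans _ hx)// exprn_ege1.
split=> //; first exact: lt_le_trans x1.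
rewrite -[leLHS](mulfVK (lt0r_neq0 hm0)) -exprSr ler_pM// ?(ltW hm0)//.
by rewrite exprn_ge0// invr_ge0 ltW.
Qed.

(** All [k] generations contribute the same bound.  The points are counted both
    for [Q] and for the pieces, so that only the constant is multiplied. *)
Lemma lower_mixture :
  (forall x a, 1 <= x ->
    ((c * (x `^ kap - (size a)%:R) / x)%:E <= w0%:E * cost r Q (barrier U a))%E) ->
  forall k x a, hm^-1 ^+ k <= x ->
  ((c * k%:R * (x `^ kap - (size a)%:R) / x)%:E <= cost r P (barrier U a))%E.
Proof.
move=> base; elim=> [|k IH] x a hx.
  by rewrite mulr0 !mul0r; exact: cost_ge0.
have [i0 _] := index_inhabited h1; have [x0 x1 _] := hmVX i0 hx.
have [a0 [b [sz _ step]]] := lower_step a.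
have xh i : hm^-1 ^+ k <= x * h i by case: (hmVX i hx).
have := step _ _ (base x a x1) (fun i => IH _ (b i) (xh i)).
apply: le_trans; rewrite lee_fin.
under eq_bigr do rewrite -[_ `^ kap]mul1r.
rewrite sum_linear// mul1r -natr_sum -natr1.
rewrite (_ : c * (k%:R + 1) * _ / x = c * (x `^ kap - (size a)%:R) / x +
  c * k%:R * (x `^ kap - (size a)%:R) / x); last by ring.
rewrite lerD2l; apply: ler_count => //; first exact: mulr_ge0.
exact: leq_trans (leq_addl _ _) sz.
Qed.

(** Here the points [a0] serving [Q] are of no use for the pieces, and vice
    versa: a point is counted only once, and so the [k] generations multiply the
    number of points that can be afforded, instead of the constant. *)
Lemma lower_mixture_separated :
  (forall x (a a0 : seq 'rV[R]_q), 1 <= x ->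
    (forall y, y \in a -> (forall i, ~ (f i @` U) y) -> y \in a0) ->
    ((c * (x `^ kap - (size a0)%:R) / x)%:E <= w0%:E * cost r Q (barrier U a))%E) ->
  forall k x a, hm^-1 ^+ k <= x ->
  ((c * (k%:R * x `^ kap - (size a)%:R) / x)%:E <= cost r P (barrier U a))%E.
Proof.
move=> base; elim=> [|k IH] x a hx.
  apply: le_trans (cost_ge0 _ _ _); rewrite lee_fin mul0r sub0r.
  have x0 : 0 < x by rewrite (lt_le_trans _ hx)// expr0.
  by rewrite pmulr_lle0 ?invr_gt0// mulrN oppr_le0 mulr_ge0.
have [i0 _] := index_inhabited h1; have [x0 x1 _] := hmVX i0 hx.
have [a0 [b [sz ha0 step]]] := lower_step a.
have xh i : hm^-1 ^+ k <= x * h i by case: (hmVX i hx).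
have := step _ _ (base x a a0 x1 ha0) (fun i => IH _ (b i) (xh i)).
apply: le_trans; rewrite lee_fin sum_linear// -natr_sum -mulrDl -mulrDr.
rewrite (_ : _ - _ + _ = k.+1%:R * x `^ kap - (size a0 + \sum_i size (b i))%:R).
  exact: ler_count.
by rewrite natrD -natr1; ring.
Qed.

End Mixture.

End LowerRecursion.

(** * The strong open set condition *)

Lemma enorm_lt_coord (R : realType) (q : nat) (x : 'rV[R]_q) e :
  0 < e -> (forall i, `|x 0 i| < e) -> enorm x <= q%:R * e.
Proof.
move=> e0 h; apply: le_trans (enorm_le_mx_norm _) _; rewrite ler_wpM2l//.
rewrite [leLHS]/Num.Def.normr /= mx_normrE.
by apply: bigmax_le => [|[i j] _]; rewrite ?(ltW e0)//= ord1 ltW.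
Qed.

(** Points at mutual distance at least [d] in a ball lie in different cells of
    a grid of mesh [m^-1], where [q / m < d]. *)
Lemma packing (R : realType) (q : nat) (K d : R) : 0 < d ->
  exists n, forall (T : eqType) (l : seq T) (phi : T -> 'rV[R]_q), uniq l ->
    (forall t, t \in l -> enorm (phi t) <= K) ->
    (forall t t', t \in l -> t' \in l -> t != t' -> d <= enorm (phi t - phi t')) ->
    (size l <= n)%N.
Proof.
move=> d0.
have [m m0 hm] : exists2 m : R, 0 < m & q%:R < m * d.
  by exists ((q%:R + 1) / d); rewrite ?divr_gt0 ?ltr_wpDl// divfK ?gt_eqF// ltrDl.
pose b := Num.bound (`|K| *+ 2 * m).
exists #|{ffun 'I_q -> 'I_b.+1}| => T l phi ul lK ld.
pose v t j := (phi t 0 j + `|K|) * m.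
pose psi t : {ffun 'I_q -> 'I_b.+1} := [ffun j => inord (Num.truncn (v t j))].
have coord t j : t \in l -> 0 <= v t j <= `|K| *+ 2 * m.
  move=> /lK tK; have := le_trans (coord_le_enorm (phi t) j) (le_trans tK (ler_norm K)).
  rewrite ler_norml => /andP[h1 h2]; rewrite /v mulr_ge0 ?(ltW m0)//=; last lra.
  by rewrite ler_pM2r// mulr2n; lra.
have psi_inj : {in l &, injective psi}.
  move=> t t' tl t'l; have [//|tt'] := eqVneq t t' => e; exfalso.
  have := ld _ _ tl t'l tt'; apply/negP; rewrite -ltNge.
  apply: (@le_lt_trans _ _ (q%:R * m^-1)); last by rewrite ltr_pdivrMr// mulrC.
  apply: enorm_lt_coord => [|j]; first by rewrite invr_gt0.
  have /(congr1 (@nat_of_ord _)) : psi t j = psi t' j by rewrite e.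
  have trunc_lt u : u \in l -> (Num.truncn (v u j) < b.+1)%N.
    move=> /(coord _ j)/andP[h0 h1].
    have /andP[h2 _] := truncn_itv h0.
    rewrite ltnS -(ler_nat R) (le_trans h2)// (le_trans h1)// ltW// archi_boundP//.
    exact: le_trans h0 h1.
  rewrite !ffunE !inordK ?trunc_lt// => et.
  have /andP[/truncn_itv/andP[h1 h2] _] := coord _ j tl.
  have /andP[/truncn_itv/andP[h3 h4] _] := coord _ j t'l.
  rewrite et in h1 h2; rewrite -natr1 in h2 h4.
  rewrite !mxE -(ltr_pM2r m0) mulVf ?gt_eqF// -[X in _ * X](gtr0_norm m0) -normrM.
  rewrite ltr_norml mulrBl; rewrite /v !mulrDl in h1 h2 h3 h4; apply/andP; split; lra.
rewrite -(size_map psi); have /card_uniqP <- : uniq (map psi l) by rewrite map_inj_in_uniq.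
exact: max_card.
Qed.

Section Words.
Variables (R : realType) (q M : nat) (g : 'I_M -> 'rV[R]_q -> 'rV[R]_q) (c : 'I_M -> R).
Hypothesis g_sim : forall i, contractive_similitude (g i) (c i).
Implicit Types sigma tau rho : seq 'I_M.

Definition word_map sigma : 'rV[R]_q -> 'rV[R]_q := foldr (fun i phi => g i \o phi) id sigma.

Definition word_ratio sigma : R := \prod_(i <- sigma) c i.

Lemma word_map_cat sigma tau x :
  word_map (sigma ++ tau) x = word_map sigma (word_map tau x).
Proof. by elim: sigma => //= i sigma ->. Qed.

Lemma word_ratio_cat sigma tau :
  word_ratio (sigma ++ tau) = word_ratio sigma * word_ratio tau.
Proof. exact: big_cat. Qed.

Lemma word_ratio_cons i sigma : word_ratio (i :: sigma) = c i * word_ratio sigma.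
Proof. exact: big_cons. Qed.

Lemma word_map_similitude sigma : similitude (word_map sigma) (word_ratio sigma).
Proof.
elim: sigma => [|i sigma IH]; first by rewrite /word_ratio big_nil; exact: similitude_id.
rewrite word_ratio_cons; apply: similitude_comp IH.
exact: contractive_similitudeW (g_sim i).
Qed.

Lemma word_ratio_gt0 sigma : 0 < word_ratio sigma.
Proof. exact: (word_map_similitude sigma).1. Qed.

Lemma word_ratio_le1 sigma : word_ratio sigma <= 1.
Proof.
apply: prodr_ile1 => i _; have [/andP[c0 c1] _] := g_sim i.
by rewrite !ltW.
Qed.

Lemma word_ratio_lt1 i sigma : word_ratio (i :: sigma) < 1.
Proof.
have [/andP[c0 c1] _] := g_sim i; rewrite word_ratio_cons.
apply: le_lt_trans c1; rewrite ler_piMr ?(ltW c0)//; exact: word_ratio_le1.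
Qed.

Lemma word_map_dist sigma x y :
  enorm (word_map sigma x - word_map sigma y) = word_ratio sigma * enorm (x - y).
Proof. exact: (word_map_similitude sigma).2. Qed.

(** [sigma] is the first word along its branch whose ratio is at most [b]. *)
Definition cut_at b sigma : Prop :=
  word_ratio sigma <= b /\
  forall tau, prefix tau sigma -> tau != sigma -> b < word_ratio tau.

Lemma cut_at_antichain b sigma tau :
  cut_at b sigma -> cut_at b tau -> prefix sigma tau -> sigma = tau.
Proof.
move=> [hs _] [_ ht] st; apply/eqP; apply: contraT => /(ht _ st).
by rewrite ltNge hs.
Qed.

Lemma cut_at_exists b sigma : word_ratio sigma <= b ->
  exists tau pi, sigma = tau ++ pi /\ cut_at b tau.
Proof.
move=> hs; have ex : exists k, word_ratio (take k sigma) <= b.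
  by exists (size sigma); rewrite take_size.
have [m hm mmin] := ex_minnP ex; exists (take m sigma), (drop m sigma).
split; first by rewrite cat_take_drop.
split=> // tau; rewrite prefixE => /eqP tE tne; rewrite ltNge; apply/negP => ht.
have tm : (size tau < m)%N.
  rewrite ltnNge; apply/negP => mt; move/eqP: tne; apply; rewrite -tE take_oversize//.
  by rewrite size_take_min; apply: leq_trans mt; exact: geq_minl.
have := mmin (size tau); rewrite -(take_takel sigma (ltnW tm)) tE => /(_ ht).
by rewrite leqNgt tm.
Qed.

Lemma cut_at_cat b rho sigma : b < 1 -> cut_at b sigma ->
  cut_at (word_ratio rho * b) (rho ++ sigma).
Proof.
move=> b1 [hs hp]; split; first by rewrite word_ratio_cat ler_pM2l ?word_ratio_gt0.
move=> tau; rewrite prefixE take_cat; case: ltnP => _ /eqP tE tne.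
  apply: (@lt_le_trans _ _ (word_ratio rho)).
    by rewrite gtr_pMr ?word_ratio_gt0.
  rewrite -[rho in leLHS](cat_take_drop (size tau)) word_ratio_cat tE.
  by rewrite ler_piMr ?word_ratio_le1// ltW ?word_ratio_gt0.
rewrite -tE word_ratio_cat ltr_pM2l ?word_ratio_gt0//; apply: hp.
  by rewrite prefixE; apply/eqP; rewrite size_take_min take_min take_size.
by apply: contra tne => /eqP t'E; rewrite -tE t'E.
Qed.

Section OpenSetCondition.
Variables (rho0 : R) (U0 : set 'rV[R]_q).
Let X : set 'rV[R]_q := cball rho0.
Hypothesis gX : forall i x, X x -> X (g i x).
Hypotheses (U0_nonempty : U0 !=set0) (U0_open : open U0).
Hypotheses (tU0 : trivIset setT (fun i => g i @` U0)) (gU0 : \bigcup_i (g i @` U0) `<=` U0).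

Lemma word_map_stable (A : set 'rV[R]_q) sigma x :
  (forall i y, A y -> A (g i y)) -> A x -> A (word_map sigma x).
Proof. by move=> gA Ax; elim: sigma => //= i sigma; exact: gA. Qed.

Lemma word_map_disjoint sigma tau x y : ~~ prefix sigma tau -> ~~ prefix tau sigma ->
  U0 x -> U0 y -> word_map sigma x != word_map tau y.
Proof.
have gU i z : U0 z -> U0 (g i z) by move=> Uz; apply: gU0; exists i => //; exists z.
move=> + + Ux Uy; elim: sigma tau => [|i sigma IH] [|j tau] //=.
have [<-|ij] := eqVneq i j; rewrite ?eqxx//=.
  move=> st ts; apply: contra (IH tau st ts) => /eqP.
  by move/(similitude_inj (contractive_similitudeW (g_sim i))) => ->.
move=> _ _; apply: contra ij => /eqP e; apply/eqP; apply: tU0 => //.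
exists (g i (word_map sigma x)); split.
  by exists (word_map sigma x) => //; exact: word_map_stable.
by rewrite e; exists (word_map tau y) => //; exact: word_map_stable.
Qed.

(** The piece of [tau] has about the size of the piece of [sigma], and lies within
    that size of it. *)
Definition neighbour sigma tau : Prop :=
  cut_at (word_ratio sigma) tau /\
  exists x y, [/\ X x, X y & enorm (word_map sigma x - word_map tau y) < word_ratio sigma].

Lemma neighbour_cat rho sigma tau : sigma != [::] -> neighbour sigma tau ->
  neighbour (rho ++ sigma) (rho ++ tau).
Proof.
move=> sne [ct [x [y [Xx Xy xy]]]]; split.
  rewrite word_ratio_cat; apply: cut_at_cat => //.
  by case: (sigma) sne => // i s' _; exact: word_ratio_lt1.
exists x, y; split => //.
by rewrite !word_map_cat word_map_dist word_ratio_cat ltr_pM2l ?word_ratio_gt0.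
Qed.

(** Images of a fixed point of [U0] under incomparable words are separated, on
    the scale of the words, because the images of a ball around it are
    disjoint; so only boundedly many of them fit in a ball of that scale. *)
Lemma neighbour_bounded : exists n, forall sigma (l : seq (seq 'I_M)), sigma != [::] ->
  uniq l -> (forall tau, tau \in l -> neighbour sigma tau) -> (size l <= n)%N.
Proof.
have [z0 Uz0] := U0_nonempty.
have [e /= e0 eU] : exists2 e : R, 0 < e & ball z0 e `<=` U0.
  by move: U0_open; rewrite openE => /(_ _ Uz0)/nbhs_ballP.
have c01 i : 0 < c i < 1 := (g_sim i).1.
have [cm [cM [/andP[cm0 _] _ hcm]]] := finite_bounds01 c01.
have separated sigma tau : ~~ prefix sigma tau -> ~~ prefix tau sigma ->
    word_ratio sigma * e <= enorm (word_map sigma z0 - word_map tau z0).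
  move=> st ts; rewrite leNgt; apply/negP => lt.
  have [y yE] := similitude_surj (word_map tau z0) (word_map_similitude sigma).
  have Uy : U0 y.
    apply: eU; apply: ball_enorm => //.
    by move: lt; rewrite -yE word_map_dist ltr_pM2l ?word_ratio_gt0.
  by have := word_map_disjoint st ts Uy Uz0; rewrite yE eqxx.
pose K := (enorm z0 + rho0) *+ 2 + 1.
have [n hn] := @packing R q K (cm * e) (mulr_gt0 cm0 e0); exists n => sigma l sne ul hl.
pose b := word_ratio sigma; have b0 : 0 < b := word_ratio_gt0 sigma.
have b1 : b < 1 by rewrite /b; case: (sigma) sne => // i s' _; exact: word_ratio_lt1.
apply: (hn _ l (fun tau => b^-1 *: (word_map tau z0 - word_map sigma z0))) => //.
- move=> tau /hl[[tb _] [x [y [Xx Xy xy]]]].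
  rewrite enormZ gtr0_norm ?invr_gt0// mulrC ler_pdivrMr//.
  have h u u' : X u' -> word_ratio u <= b ->
      enorm (word_map u z0 - word_map u u') <= b * (enorm z0 + rho0).
    move=> Xu ub; rewrite word_map_dist ler_pM ?enorm_ge0 ?(ltW (word_ratio_gt0 _))//.
    by apply: le_trans (enormD _ _) _; rewrite enormN lerD2l.
  apply: le_trans (enorm_triangle _ (word_map tau y) _) _.
  have := enorm_triangle (word_map tau y) (word_map sigma x) (word_map sigma z0).
  have h1 := h tau y Xy tb; have := h sigma x Xx (lexx _); rewrite enormB => h2 h3.
  rewrite enormB -/b in xy.
  by rewrite /K mulrDl mul1r mulr2n mulrDl (mulrC _ b); lra.
- move=> tau tau' tl t'l tt'; rewrite -scalerBr opprB addrA subrK.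
  have [ct _] := hl _ tl; have [ct' _] := hl _ t'l.
  have st : ~~ prefix tau tau' by apply: contra tt' => /(cut_at_antichain ct ct')/eqP.
  have ts : ~~ prefix tau' tau.
    by apply: contra tt' => /(cut_at_antichain ct' ct)/esym/eqP.
  rewrite enormZ gtr0_norm ?invr_gt0// [leRHS]mulrC ler_pdivlMr//.
  apply: le_trans (separated _ _ st ts); rewrite mulrAC ler_pM2r// mulrC.
  case/lastP: tau ct {tl tt' st ts} => [[]|tau i [_]].
    by rewrite /word_ratio big_nil leNgt b1.
  move=> /(_ tau (prefix_rcons _ _)) h.
  rewrite /word_ratio -cats1 big_cat/= big_seq1 ler_pM ?(ltW b0) ?(ltW cm0)//.
    apply/ltW/h; apply/eqP => /(congr1 size); rewrite size_rcons.
    by move/eqP; rewrite eqn_leq ltnn andbF.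
  by have /andP[] := hcm i.
Qed.

(** Copying under [rho] turns the neighbours of [sigma] into neighbours of
    [rho ++ sigma].  When their number is maximal, there can be no others, so that
    all neighbours of [rho ++ sigma] lie inside the piece of [rho]. *)
Lemma maximal_neighbourhood : (0 < M)%N -> exists sigma, sigma != [::] /\
  forall rho tau, neighbour (rho ++ sigma) tau -> exists tau', tau = rho ++ tau'.
Proof.
move=> M0; have [n hn] := neighbour_bounded.
(* [k] is the number of distinct neighbours found for some word. *)
pose Pk k := `[< exists sigma (l : seq (seq 'I_M)), [/\ sigma != [::], uniq l,
  forall tau, tau \in l -> neighbour sigma tau & size l = k] >].
have exP : exists k, Pk k by exists 0%N; apply/asboolP; exists [:: Ordinal M0], [::].
have leP k : Pk k -> (k <= n)%N.
  by move=> /asboolP[sigma [l [sne ul hl <-]]]; exact: hn hl.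
have [k /asboolP[sigma [l [sne ul hl sl]]] kmax] := ex_maxnP exP leP.
exists sigma; split=> // rho tau ht.
have [/mapP[tau' _ ->]|tl] := boolP (tau \in map (cat rho) l); first by exists tau'.
exfalso; suff /kmax : Pk k.+1 by rewrite ltnn.
apply/asboolP; exists (rho ++ sigma), (tau :: map (cat rho) l); split.
- by case: (rho).
- rewrite /= tl map_inj_uniq// => u v /eqP; rewrite eqseq_cat// eqxx/=.
  by move/eqP.
- move=> u; rewrite inE => /orP[/eqP->//|/mapP[v vl ->]].
  by apply: neighbour_cat => //; exact: hl.
- by rewrite /= size_map sl.
Qed.

(** Schief's theorem: the open set can be chosen to contain a whole piece of the
    attractor, here a neighbourhood of the image of an invariant ball [X].  It is
    the union of the images of a neighbourhood [V] of a piece with a maximal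
    number of neighbours.  If the copies of [V] under two words with different
    first letters met, the smaller of the two pieces would lie in a neighbour of
    the larger one, and that neighbour would start with the wrong letter. *)
Theorem strong_open_set_condition : (0 < M)%N ->
  exists (U : set 'rV[R]_q) (sigma : seq 'I_M) (d : R),
  [/\ \bigcup_i (g i @` U) `<=` U, trivIset setT (fun i => g i @` U), 0 < d &
      forall x y, X x -> enorm (y - word_map sigma x) < d -> U y].
Proof.
move=> M0; have [sigma [sne hmax]] := maximal_neighbourhood M0.
pose V rho := [set y : 'rV[R]_q | exists2 x, X x &
  enorm (y - word_map (rho ++ sigma) x) < word_ratio (rho ++ sigma) / 2].
have gV i rho y : V rho y -> V (i :: rho) (g i y).
  move=> [x Xx yx]; exists x => //; rewrite cat_cons word_ratio_cons/=.
  rewrite (g_sim i).2 -mulrA ltr_pM2l//.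
  by have [/andP[]] := g_sim i.
have disj i j rho rho' y : word_ratio (j :: rho' ++ sigma) <= word_ratio (i :: rho ++ sigma) ->
    V (i :: rho) y -> V (j :: rho') y -> i = j.
  move=> le [x Xx yx] [x' Xx' yx'].
  have [tau [pi [tE ct]]] := cut_at_exists le.
  have [|tau' tauE] := hmax (i :: rho) tau.
    split=> //; exists x, (word_map pi x'); split=> //.
      by apply: (word_map_stable (A := X)).
    rewrite -word_map_cat -tE.
    have := enorm_triangle (word_map ((i :: rho) ++ sigma) x) y
      (word_map ((j :: rho') ++ sigma) x').
    rewrite (enormB _ y); rewrite !cat_cons in yx yx' le *; lra.
  by move: tE; rewrite tauE => -[].
exists [set y | exists rho, V rho y], sigma, (word_ratio sigma / 2); split.
- by move=> _ [i _ [y [rho Vy] <-]]; exists (i :: rho); exact: gV.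
- move=> i j _ _ [y [[u [rho Vu] uy] [u' [rho' Vu'] uy']]].
  have Vy : V (i :: rho) y by rewrite -uy; exact: gV.
  have Vy' : V (j :: rho') y by rewrite -uy'; exact: gV.
  have [le|/ltW le] := leP (word_ratio (j :: rho' ++ sigma)) (word_ratio (i :: rho ++ sigma)).
    exact: disj le Vy Vy'.
  by apply/esym; exact: disj le Vy' Vy.
- by rewrite divr_gt0// word_ratio_gt0.
- by move=> x y Xx yx; exists [::]; exists x.
Qed.

End OpenSetCondition.

End Words.

(** * From costs to quantization errors *)

Section QuantizationError.
Variables (R : realType) (q : nat) (r : R) (P : probability (borel R q) R).
Hypothesis r0 : 0 < r.

(** Sets of at most [n] points are handled as sequences of length at most [n],
    which are easier to distribute among the pieces. *)
Lemma card_le_seq (alpha : set 'rV[R]_q) n : (alpha #<= `I_n)%card ->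
  exists2 a : seq 'rV[R]_q, alpha = [set` a] & (size a <= n)%N.
Proof.
move=> le; have fin : finite_set alpha by exact: card_le_finite le (finite_II n).
have [m am] := fin; exists (finmap.enum_fset (fset_set alpha)).
  by rewrite -[LHS]fset_setK.
by rewrite (card_fset_set am) -card_le_II -(card_le_eql am).
Qed.

Lemma seq_card_le (a : seq 'rV[R]_q) n : (size a <= n)%N -> ([set` a] #<= `I_n)%card.
Proof.
move=> an; rewrite (_ : [set` a] = nth 0 a @` `I_(size a)).
  by apply: card_le_trans (card_image_le _ _) _; rewrite card_le_II.
apply/seteqP; split=> [x /= /(nthP 0)[i ia <-]|_ [i ia <-]]; first by exists i.
exact: mem_nth.
Qed.

Let poweRK x : (0 <= x)%E -> ((x `^ r^-1) `^ r = x)%E.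
Proof. by move=> x0; rewrite -poweRrM mulVf ?gt_eqF// poweRe1. Qed.

Let poweR_le (x y : \bar R) e : 0 <= e -> (0 <= x)%E -> (x <= y)%E -> (x `^ e <= y `^ e)%E.
Proof.
move=> e0 x0 xy; apply: gt0_ler_poweR => //; rewrite in_itv/= leey andbT//.
exact: le_trans xy.
Qed.

Lemma quant_error_ge0 n : (0 <= quant_error r P n)%E.
Proof. by apply: le_ereal_inf_tmp => _ [alpha _ <-]; exact: poweR_ge0. Qed.

Lemma quant_error_le n (a : seq 'rV[R]_q) v : a != [::] -> (size a <= n)%N ->
  (cost r P [set` a] <= v)%E -> (quant_error r P n `^ r <= v)%E.
Proof.
move=> ane an; apply: le_trans; rewrite -[leRHS]poweRK ?cost_ge0//.
apply: poweR_le; rewrite ?(ltW r0) ?quant_error_ge0//.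
apply: ereal_inf_lbound; exists [set` a]; last by rewrite cost.unlock.
split; last exact: seq_card_le.
by case: (a) ane => // x l _; exists x; rewrite /= inE eqxx.
Qed.

Lemma le_quant_error n v : 0 <= v ->
  (forall a : seq 'rV[R]_q, a != [::] -> (size a <= n)%N -> (v%:E <= cost r P [set` a])%E) ->
  (v%:E <= quant_error r P n `^ r)%E.
Proof.
move=> v0 h; rewrite -[leLHS]poweRK ?lee_fin//.
apply: poweR_le; rewrite ?(ltW r0) ?poweR_ge0//.
apply: le_ereal_inf_tmp => _ [alpha [ane /card_le_seq[a aE an]] <-].
have := h a; rewrite -aE cost.unlock => {}h.
apply: poweR_le; rewrite ?invr_ge0 ?(ltW r0) ?lee_fin//; apply: h => //.
by move: ane; rewrite aE; case: (a) => // -[x]; rewrite /= in_nil.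
Qed.

End QuantizationError.

Section Asymptotics.
Variables (R : realType) (q : nat) (r : R) (P : probability (borel R q) R) (xi : R).
Hypotheses (r0 : 0 < r) (xi0 : 0 < xi).

Let kap := xi / (xi + r).
Let e := r / xi.

Lemma kappa01 : 0 < kap < 1.
Proof.
by rewrite divr_gt0 ?addr_gt0//= ltr_pdivrMr ?addr_gt0// mul1r ltrDl.
Qed.

Let kap0 : 0 < kap. Proof. by case/andP: kappa01. Qed.

Let kapV : kap^-1 = 1 + e.
Proof. by rewrite /kap /e; field; rewrite !gt_eqF// addr_gt0. Qed.

Let kapVE : kap^-1 = (xi + r) / xi.
Proof. by rewrite /kap invf_div. Qed.

Let e0 : 0 < e. Proof. exact: divr_gt0. Qed.

Let near_large (B : R) : \forall n \near \oo, [/\ (0 < n)%N, 1 <= ln n%:R :> R & B <= ln n%:R].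
Proof.
near=> n.
have h : expR (Num.max 1 B) <= n%:R.
  apply: (@le_trans _ _ (Num.bound (expR (Num.max 1 B)))%:R).
    by rewrite ltW// archi_boundP// expR_ge0.
  by rewrite ler_nat; near: n; exact: nbhs_infty_ge.
have n0 : 0 < n%:R :> R by apply: lt_le_trans h; exact: expR_gt0.
have hln : Num.max 1 B <= ln n%:R.
  by rewrite -(expRK (Num.max 1 B)) ler_ln// posrE expR_gt0.
by rewrite -(ltr_nat R); split=> //; apply: le_trans hln; rewrite le_max lexx ?orbT.
Unshelve. all: by end_near. Qed.

(** Balancing: [k] is taken of order [ln n] and [x] such that [n] points are
    used up. *)
Lemma upper_asymptotics (A B th : R) : 1 <= A -> 0 < B -> 0 < th < 1 ->
  (forall k x, 0 < x -> x <= th^-1 ^+ k -> exists a : seq 'rV[R]_q, [/\ a != [::],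
    (size a)%:R <= (1 + k%:R) * A * x `^ kap + 1 &
    (cost r P [set` a] <= ((1 + k%:R) * B * x `^ (kap - 1))%:E)%E]) ->
  lesssim (fun n => (quant_error r P n `^ r)%E)
    (fun n => (n%:R `^ (- (r / xi)) * ln n%:R `^ ((xi + r) / xi))%:E).
Proof.
move=> A1 B0 /andP[th0 th1] happrox.
have A0 : 0 < A := lt_le_trans ltr01 A1.
have thV1 : 1 < th^-1 by rewrite invf_gt1.
pose T := ln th^-1; have T0 : 0 < T by rewrite ln_gt0.
pose G := (kap * T)^-1 + 2.
have G0 : 0 < G by rewrite ltr_wpDl// invr_ge0; apply/ltW/mulr_gt0.
exists (G * B * (2 * G * A) `^ e); first by rewrite ?(mulr_gt0, powR_gt0).
near=> n.
have [n0 L1 L2] : [/\ (0 < n)%N, 1 <= ln n%:R :> R & ln 2 <= ln n%:R :> R].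
  by near: n; exact: near_large.
set L := ln n%:R in L1 L2 *.
have n0R : 0 < n%:R :> R by rewrite ltr0n.
have n2 : 2 <= n%:R :> R by rewrite -ler_ln ?posrE.
have n1 : 0 < n%:R - 1 :> R by rewrite subr_gt0 (lt_le_trans _ n2)// ltr1n.
have n12 : n%:R <= 2 * (n%:R - 1) :> R by lra.
have L0 : 0 < L := lt_le_trans ltr01 L1.
pose k := (Num.truncn (L / (kap * T))).+1.
have kT : 0 <= L / (kap * T) by apply: divr_ge0; apply/ltW => //; exact: mulr_gt0.
have /andP[k1 k2] := truncn_itv kT; rewrite -/k in k2.
have kG : 1 + k%:R <= G * L.
  by rewrite /G mulrDl mulrC /k -natr1; lra.
pose D := (1 + k%:R) * A; have D1 : 1 <= D by rewrite -[leLHS]mulr1 ler_pM// lerDl.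
have D0 : 0 < D := lt_le_trans ltr01 D1.
(* One of the [n] points is kept in reserve for tiny budgets. *)
pose y := (n%:R - 1) / D; have y0 : 0 < y by exact: divr_gt0.
pose x := y `^ kap^-1; have x0 : 0 < x by rewrite powR_gt0.
have xk : x `^ kap = y by rewrite /x -powRrM mulVf ?gt_eqF// powRr1 ?ltW.
have xth : x <= th^-1 ^+ k.
  apply: le_exprn => //; apply: le_trans (ltW k2).
  rewrite /x ln_powR -/T [leRHS](_ : _ = kap^-1 * L / T).
    rewrite ler_wpM2r ?invr_ge0 ?(ltW T0)// ler_wpM2l ?invr_ge0 ?(ltW kap0)//.
    rewrite ler_ln ?posrE// ler_pdivrMr//.
    by apply: (@le_trans _ _ n%:R); rewrite ?ler_peMr ?(ltW n0R)// gerBl.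
  by rewrite (invfM kap T) mulrA (mulrC L).
have [a [ane sa ca]] := happrox k x x0 xth.
apply: (quant_error_le (a := a) r0) => //.
  by rewrite -(ler_nat R) (le_trans sa)// xk mulrC divfK ?gt_eqF// subrK.
apply: le_trans ca _; rewrite -EFinM lee_fin.
have -> : x `^ (kap - 1) = (D / (n%:R - 1)) `^ e.
  rewrite /x -powRrM -[D / _]invf_div -/y -[y^-1]powR_inv1 ?ltW// -powRrM.
  by congr (_ `^ _); rewrite mulrBr mulVf ?gt_eqF// kapV; ring.
have h : (D / (n%:R - 1)) `^ e <= (2 * G * A) `^ e * (L `^ e * n%:R `^ (- e)).
  have -> : n%:R `^ (- e) = n%:R^-1 `^ e :> R.
    by rewrite -[n%:R^-1]powR_inv1 ?ler0n// -powRrM mulN1r.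
  have GA0 : 0 <= 2 * G * A by rewrite !mulr_ge0 ?(ltW A0) ?(ltW G0).
  have Ln0 : 0 <= L * n%:R^-1 by rewrite mulr_ge0 ?invr_ge0 ?ler0n ?(ltW L0).
  rewrite -!powRM ?invr_ge0 ?ler0n ?(ltW L0)//.
  apply: ge0_ler_powR; rewrite ?nnegrE.
  - exact: ltW.
  - by rewrite ltW// divr_gt0.
  - exact: mulr_ge0.
  rewrite ler_pdivrMr//.
  apply: (@le_trans _ _ (G * L * A)); first by rewrite ler_wpM2r ?(ltW A0).
  rewrite (_ : 2 * G * A * _ * _ = G * L * A * (2 * (n%:R - 1) / n%:R)); last by ring.
  rewrite ler_peMr ?mulr_ge0 ?(ltW A0) ?(ltW G0) ?(ltW L0)//.
  by rewrite ler_pdivlMr// mul1r.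
rewrite -kapVE kapV powRD ?(gt_eqF L0) ?implybT// powRr1 ?(ltW L0)//.
apply: (@le_trans _ _ (G * L * B * ((2 * G * A) `^ e * (L `^ e * n%:R `^ (- e))))).
  apply: ler_pM => //; rewrite ?powR_ge0 ?mulr_ge0 ?addr_ge0 ?(ltW B0)//.
  by rewrite ler_wpM2r// (ltW B0).
rewrite le_eqVlt; apply/orP; left; apply/eqP; rewrite -/e; ring.
Unshelve. all: by end_near. Qed.

(** The number of generations for lower bounds: logarithmic in [n], and small
    enough for the budgets used below to last [k] generations. *)
Let choose_depth (H : R) : 1 <= H -> exists2 T : R, 0 < T &
  \forall n \near \oo, exists k : nat, [/\ (0 < n)%N, (0 < k)%N,
    0 <= ln (n%:R : R) <= T * k%:R & k%:R * (H ^+ k) `^ kap <= n%:R].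
Proof.
move=> H1; have H0 : 0 < H := lt_le_trans ltr01 H1.
pose T := 1 + kap * ln H; have T0 : 0 < T.
  by rewrite ltr_pwDl// mulr_ge0 ?ln_ge0 ?(ltW kap0).
exists (2 * T); first exact: mulr_gt0.
near=> n.
have [n0 L1 LT] : [/\ (0 < n)%N, 1 <= ln n%:R :> R & T <= ln n%:R :> R].
  by near: n; exact: near_large.
set L := ln n%:R in L1 LT *.
have LT1 : 1 <= L / T by rewrite ler_pdivlMr// mul1r.
have /andP[k1 k2] := truncn_itv (le_trans ler01 LT1).
set k := Num.truncn (L / T) in k1 k2.
have k0 : (0 < k)%N.
  by rewrite lt0n; apply/eqP => k0; move: k2; rewrite k0 ltNge LT1.
have k0R : 0 < k%:R :> R by rewrite ltr0n.
exists k; split=> //.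
  rewrite (le_trans ler01 L1)/= -mulrA mulrCA -ler_pdivrMl// mulrC (le_trans (ltW k2))//.
  by rewrite -natr1 mulr_natl mulr2n lerD2l ler1n.
have Hk : 0 < (H ^+ k) `^ kap by rewrite powR_gt0// exprn_gt0.
rewrite -ler_ln ?posrE ?mulr_gt0 ?ltr0n// lnM ?posrE// ln_powR lnXn//.
apply: (@le_trans _ _ (k%:R * T)); last by rewrite -ler_pdivlMr.
rewrite /T mulrDr mulr1 -(mulr_natl (ln H)) mulrCA lerD2r ltW//.
exact: ln_sublinear.
Unshelve. all: by end_near. Qed.

(** The budget for which [j * x `^ kap] is twice the number of points [n], so
    that [n] points are not enough. *)
Let budget (n : nat) (j : R) : R := (2 * n%:R / j) `^ (1 + e).

Let budget_gt0 n j : (0 < n)%N -> 0 < j -> 0 < budget n j.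
Proof. by move=> n0 j0; rewrite powR_gt0// divr_gt0// mulr_gt0// ltr0n. Qed.

Let budget_kap n j : (0 < n)%N -> 0 < j -> j * budget n j `^ kap = 2 * n%:R.
Proof.
move=> n0 j0; rewrite /budget -kapV -powRrM mulVf ?gt_eqF// powRr1; last first.
  by rewrite ltW// divr_gt0// mulr_gt0// ltr0n.
by rewrite mulrC divfK// gt_eqF.
Qed.

Let le_budget n j y : (0 < n)%N -> 0 < j -> 0 <= y -> j * y `^ kap <= n%:R -> y <= budget n j.
Proof.
move=> n0 j0 y0 h.
have -> : y = (y `^ kap) `^ (1 + e) by rewrite -kapV -powRrM mulfV ?gt_eqF// powRr1.
have n0R : 0 < n%:R :> R by rewrite ltr0n.
apply: ge0_ler_powR; rewrite ?nnegrE ?powR_ge0//.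
- by rewrite addr_ge0// ltW.
- by rewrite ltW// divr_gt0// mulr_gt0.
- rewrite ler_pdivlMr// mulrC (le_trans h)// ler_peMl ?(ltW n0R)//.
  by rewrite ler1n.
Qed.

Let div_budget n j : (0 < n)%N -> 0 < j ->
  n%:R / budget n j = 2 `^ (- (1 + e)) * (j `^ (1 + e) * n%:R `^ (- e)).
Proof.
move=> n0 j0; have n0R : 0 < n%:R :> R by rewrite ltr0n.
rewrite /budget -powRN !powRM ?mulr_ge0 ?invr_ge0 ?(ltW n0R) ?(ltW j0)//.
have -> : j^-1 `^ (- (1 + e)) = j `^ (1 + e).
  by rewrite -[j^-1]powR_inv1 ?(ltW j0)// -powRrM mulN1r opprK.
have -> : n%:R `^ (- e) = n%:R * n%:R `^ (- (1 + e)) :> R.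
  rewrite -[X in X * _]powRr1 ?(ltW n0R)// -powRD; last by rewrite (gt_eqF n0R) implybT.
  by congr (_ `^ _); ring.
ring.
Qed.

Let lower_value c x (b m : R) : 0 <= c -> 0 < x -> 2 * m <= b ->
  forall k : R, k <= m -> c * (m / x) <= c * (b - k) / x.
Proof.
move=> c0 x0 mb k km; rewrite -mulrA ler_wpM2l// ler_wpM2r ?invr_ge0 ?(ltW x0)//; lra.
Qed.

Lemma lower_asymptotics (c H : R) : 0 < c -> 1 <= H ->
  (forall k x (a : seq 'rV[R]_q), a != [::] -> H ^+ k <= x ->
    ((c * k%:R * (x `^ kap - (size a)%:R) / x)%:E <= cost r P [set` a])%E) ->
  lesssim (fun n => (n%:R `^ (- (r / xi)) * ln n%:R)%:E)
    (fun n => (quant_error r P n `^ r)%E).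
Proof.
move=> c0 H1 hlow; have [T T0 hT] := choose_depth H1.
pose d := c * 2 `^ (- (1 + e)) / T.
have d0 : 0 < d by rewrite divr_gt0// mulr_gt0// powR_gt0.
exists d^-1; first by rewrite invr_gt0.
near=> n.
have [k [n0 k0 /andP[L0 LT] kH]] : exists k : nat, [/\ (0 < n)%N, (0 < k)%N,
    0 <= ln (n%:R : R) <= T * k%:R & k%:R * (H ^+ k) `^ kap <= n%:R].
  by near: n.
have k0R : 0 < k%:R :> R by rewrite ltr0n.
have x0 := budget_gt0 n0 (@ltr01 R).
suff h : ((d * (n%:R `^ (- e) * ln n%:R))%:E <= quant_error r P n `^ r)%E.
  have := lee_wpmul2l _ h; move=> /(_ (d^-1)%:E); rewrite lee_fin invr_ge0 (ltW d0).
  by move=> /(_ isT); rewrite -EFinM mulKf ?gt_eqF.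
apply: le_quant_error => //.
  by apply: mulr_ge0; [exact: ltW|apply: mulr_ge0 => //; exact: powR_ge0].
move=> a ane an.
have Hx : H ^+ k <= budget n 1.
  apply: le_budget => //; first by rewrite exprn_ge0// (le_trans ler01).
  rewrite mul1r (le_trans _ kH)// ler_peMl ?powR_ge0//.
  by rewrite ler1n.
apply: le_trans (hlow k _ a ane Hx); rewrite lee_fin.
have ck0 : 0 <= c * k%:R by rewrite mulr_ge0 ?(ltW c0).
have := budget_kap n0 (@ltr01 R); rewrite mul1r => bk.
apply: (le_trans _ (lower_value ck0 x0 _ (_ : (size a)%:R <= n%:R))); rewrite ?ler_nat ?bk//.
rewrite div_budget// powR1 mul1r.
rewrite [leLHS](_ : _ = c * 2 `^ (- (1 + e)) * n%:R `^ (- e) * (ln n%:R / T)); last first.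
  by rewrite /d; ring.
rewrite [leRHS](_ : _ = c * 2 `^ (- (1 + e)) * n%:R `^ (- e) * k%:R); last by ring.
by rewrite ler_wpM2l ?mulr_ge0 ?powR_ge0 ?(ltW c0)// ler_pdivrMr// mulrC.
Unshelve. all: by end_near. Qed.

Lemma lower_asymptotics_separated (c H : R) : 0 < c -> 1 <= H ->
  (forall k x (a : seq 'rV[R]_q), a != [::] -> H ^+ k <= x ->
    ((c * (k%:R * x `^ kap - (size a)%:R) / x)%:E <= cost r P [set` a])%E) ->
  gtrsim (fun n => (quant_error r P n `^ r)%E)
    (fun n => (n%:R `^ (- (r / xi)) * ln n%:R `^ ((xi + r) / xi))%:E).
Proof.
move=> c0 H1 hlow; have [T T0 hT] := choose_depth H1.
pose d := c * 2 `^ (- (1 + e)) * T^-1 `^ (1 + e).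
have d0 : 0 < d by rewrite ?(mulr_gt0, powR_gt0) ?invr_gt0.
exists d => //.
near=> n.
have [k [n0 k0 /andP[L0 LT] kH]] : exists k : nat, [/\ (0 < n)%N, (0 < k)%N,
    0 <= ln (n%:R : R) <= T * k%:R & k%:R * (H ^+ k) `^ kap <= n%:R].
  by near: n.
have k0R : 0 < k%:R :> R by rewrite ltr0n.
have x0 := budget_gt0 n0 k0R.
rewrite -EFinM; apply: le_quant_error => //.
  by apply: mulr_ge0; [exact: ltW|apply: mulr_ge0; exact: powR_ge0].
move=> a ane an.
have Hx : H ^+ k <= budget n k%:R.
  by apply: le_budget => //; rewrite exprn_ge0// (le_trans ler01).
apply: le_trans (hlow k _ a ane Hx); rewrite lee_fin.
apply: (le_trans _ (lower_value (ltW c0) x0 _ (_ : (size a)%:R <= n%:R)));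
  rewrite ?ler_nat ?budget_kap//.
rewrite div_budget// -kapVE kapV -/e.
rewrite [leLHS](_ : _ = c * 2 `^ (- (1 + e)) * n%:R `^ (- e) *
    (T^-1 `^ (1 + e) * ln n%:R `^ (1 + e))).
  rewrite [leRHS](_ : _ = c * 2 `^ (- (1 + e)) * n%:R `^ (- e) *
    k%:R `^ (1 + e)); last by ring.
  rewrite ler_wpM2l ?mulr_ge0 ?powR_ge0 ?(ltW c0)// -powRM ?invr_ge0 ?(ltW T0)//.
  apply: ge0_ler_powR; rewrite ?nnegrE ?mulr_ge0 ?invr_ge0 ?(ltW T0)//.
    by rewrite addr_ge0// ltW.
  by rewrite ler_pdivrMl.
by rewrite /d; ring.
Unshelve. all: by end_near. Qed.

End Asymptotics.

(** * Self-similar measures *)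

Section SelfSimilar.
Variables (R : realType) (q M : nat) (g : 'I_M -> 'rV[R]_q -> 'rV[R]_q).
Variables (c t : 'I_M -> R) (nu : probability (borel R q) R) (r kap rho : R).
Hypotheses (g_sim : forall i, contractive_similitude (g i) (c i)) (M2 : (2 <= M)%N).
Hypotheses (tp : pos_prob_vector t) (nuE : self_similar_measure g t nu).
Hypotheses (r0 : 0 < r) (kap01 : 0 < kap < 1) (h1 : \sum_i (t i * c i `^ r) `^ kap = 1).
Hypothesis nurho : nu (~` @cball R q rho) = 0%E.
Hypothesis g_rho : forall i x, @cball R q rho x -> @cball R q rho (g i x).

Let nu_mix : mixture g 0 t nu nu.
Proof. by move=> A mA; rewrite mul0e add0e; exact: nuE. Qed.

Let t_gt0 i : 0 < t i := tp.1 i.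

Lemma scaled_weight01 (w s : R) (f : 'rV[R]_q -> 'rV[R]_q) : 0 < w <= 1 ->
  contractive_similitude f s -> 0 < w * s `^ r < 1.
Proof.
move=> /andP[w0 w1] [/andP[s0 s1] _]; rewrite mulr_gt0 ?powR_gt0//=.
apply: (@le_lt_trans _ _ (s `^ r)); first by rewrite ler_piMl ?powR_ge0.
have <- : 1 `^ r = 1 :> R by rewrite powR1.
by apply: gt0_ltr_powR; rewrite ?nnegrE ?(ltW s0).
Qed.

Let h01 i : 0 < t i * c i `^ r < 1.
Proof.
apply: scaled_weight01 (g_sim i); rewrite t_gt0/= -tp.2 (bigD1 i)//= lerDl.
by apply: sumr_ge0 => j _; exact: ltW.
Qed.

(** The recursion stops after finitely many generations, at no extra cost since
    nothing is added in between. *)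
Lemma self_similar_upper : exists A B : R, [/\ 0 < A, 0 < B &
  forall x, 1 <= x -> exists a : seq 'rV[R]_q, [/\ a != [::],
    (size a)%:R <= A * x `^ kap & (cost r nu [set` a] <= (B * x `^ (kap - 1))%:E)%E]].
Proof.
have [kap0 kap1] := andP kap01.
have [hm [th [hm01 th01 hb]]] := finite_bounds01 h01.
have [[hm0 hm1] [th0 th1]] := (andP hm01, andP th01).
exists hm^-1, (rho `^ r + 1); split; first by rewrite invr_gt0.
  by rewrite ltr_wpDl ?powR_ge0.
move=> x x1; have [k hk] := @le_exprn_exists R th^-1 x ltac:(by rewrite invf_gt1).
have [||x' x'1|a [ane sa ca]] := upper_recursion (A := hm^-1) (B := rho `^ r + 1) (D := 0)
    g_sim (lexx 0) t_gt0 r0 nu_mix kap0 kap1 h1 hm01 th01 hb nurho _ _ (lexx 0) _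
    (le_trans hm1 x1) hk.
- by rewrite mulVf ?gt_eqF.
- by rewrite lerDl.
- by exists [::]; split; [left| |]; rewrite ?mul0r ?mul0e.
by exists a; split => //; move: sa ca; rewrite mul0r addr0 !mul1r.
Qed.

(** Only the piece coded by [sigma] is kept. *)
Lemma integral_word_ge sigma (phi : borel R q -> R) :
  measurable_fun [set: borel R q] phi -> (forall x, 0 <= phi x) ->
  ((\prod_(i <- sigma) t i)%:E * \int[nu]_x (phi (word_map g sigma x))%:E
    <= \int[nu]_x (phi x)%:E)%E.
Proof.
elim: sigma phi => [|i sigma IH] phi mphi phi0; first by rewrite big_nil mul1e.
have mg := continuous_borel (similitude_continuous (contractive_similitudeW (g_sim i))).
have mphig : measurable_fun [set: borel R q] (fun x : borel R q => phi (g i x)).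
  exact: measurableT_comp mphi mg.
rewrite big_cons EFinM -muleA.
have ti0 : (0 <= (t i)%:E)%E by rewrite lee_fin ltW.
apply: le_trans (lee_wpmul2l ti0 (IH _ mphig (fun x => phi0 _))) _.
rewrite [leRHS](self_similar_integral (lexx 0) (fun i => ltW (t_gt0 i)) _ nu_mix)//; last first.
  by move=> j; exact: similitude_continuous (contractive_similitudeW (g_sim j)).
rewrite mul0e add0e (bigD1 i)//= leeDl//; apply: sume_ge0 => j _.
by apply: mule_ge0; [rewrite lee_fin ltW|apply: integral_ge0 => x _; rewrite lee_fin].
Qed.

(** Similitudes are onto, so two images of the whole space would meet. *)
Lemma setC_nonempty (U : set 'rV[R]_q) : trivIset setT (fun i => g i @` U) -> ~` U !=set0.
Proof.
move=> tU; apply: contrapT => /set0P/negP; rewrite negbK => /eqP UC.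
have UT x : U x by apply: contrapT => nUx; have : (~` U) x by []; rewrite UC.
pose i0 : 'I_M := Ordinal (ltn_trans (isT : 0 < 1)%N M2); pose i1 : 'I_M := Ordinal M2.
have [y yE] := similitude_surj (g i0 0) (contractive_similitudeW (g_sim i1)).
suff : i0 = i1 by [].
by apply: tU => //; exists (g i0 0); split; [exists 0|exists y].
Qed.

(** The strong open set condition makes the cost of the complement of [U]
    positive, and this starts the lower recursion. *)
Lemma self_similar_lower : open_set_condition g ->
  exists (U : set 'rV[R]_q) (C : R), [/\ \bigcup_i (g i @` U) `<=` U,
    trivIset setT (fun i => g i @` U), ~` U !=set0, 0 < C &
    forall x a, 1 <= x ->
    ((C * (x `^ kap - (size a)%:R) / x)%:E <= cost r nu (barrier U a))%E].
Proof.
move=> [U0 [U0ne oU0 _ tU0 gU0]].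
have [U [sigma [d [gU tU d0 dU]]]] := strong_open_set_condition g_sim g_rho
  U0ne oU0 tU0 gU0 (ltnW M2).
have UC := setC_nonempty tU.
pose c0 := (\prod_(i <- sigma) t i) * d `^ r.
have c00 : 0 < c0 by rewrite mulr_gt0 ?powR_gt0// prodr_gt0.
have hc0 : (c0%:E <= cost r nu (~` U))%E.
  have mU := measurable_dist_powR r UC.
  have := integral_word_ge sigma mU (fun x => powR_ge0 _ _).
  rewrite cost.unlock; apply: le_trans; rewrite EFinM.
  apply: lee_wpmul2l; first by rewrite lee_fin prodr_ge0// => i _; exact: ltW.
  apply: (cst_le_integral_null _ nurho).
  - by apply: closed_borel; exact: cball_closed.
  - have ms := continuous_borel (similitude_continuous (word_map_similitude g_sim sigma)).
    exact: measurableT_comp mU ms.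
  - by move=> x; exact: powR_ge0.
  - exact: powR_ge0.
  move=> x xrho; apply: ge0_ler_powR; rewrite ?nnegrE ?dist_to_ge0 ?(ltW r0) ?(ltW d0)//.
  apply: le_dist_to => // a; apply: contra_notT; rewrite -ltNge => xa.
  by apply: dU xrho _; rewrite enormB.
have [kap0 kap1] := andP kap01.
have [hm [th [hm01 th01 hb]]] := finite_bounds01 h01.
have [[hm0 hm1] [th0 th1]] := (andP hm01, andP th01).
exists U, (c0 * hm); split=> //; first exact: mulr_gt0.
move=> x a x1; have [k hk] := @le_exprn_exists R th^-1 x ltac:(by rewrite invf_gt1).
have hbl i : hm <= t i * c i `^ r by have /andP[] := hb i.
have hbr i : t i * c i `^ r <= th by have /andP[] := hb i.
exact: (lower_self_similar g_sim (lexx 0) t_gt0 r0 nu_mix gU tU UC kap0 h1 hm01 hbl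
  a erefl th01 hbr (ltW c00) hc0 (le_trans hm1 x1) hk).
Qed.

End SelfSimilar.

Lemma compact_dist_to (R : realType) (q : nat) (C A : set 'rV[R]_q) :
  compact C -> A !=set0 -> (forall y, C y -> 0 < dist_to y A) ->
  exists d : R, 0 < d /\ forall y, C y -> d <= dist_to y A.
Proof.
move=> cC A0 pos; have [->|/set0P C0] := eqVneq C set0; first by exists 1.
have [y yC ymin] := EVT_min_rV C0 cC (continuous_subspaceT (dist_to_continuous A0)).
exists (dist_to y A); split; first by apply: pos; rewrite inE in yC.
by move=> z Cz; apply: ymin; rewrite inE.
Qed.

(** * In-homogeneous self-similar measures *)

Section InhomogeneousSelfSimilar.
Variables (R : realType) (q N : nat) (f : 'I_N -> 'rV[R]_q -> 'rV[R]_q) (s : 'I_N -> R).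
Variables (p : 'I_N.+1 -> R) (nu mu : probability (borel R q) R) (r xi rho : R).
Hypotheses (f_sim : forall i, contractive_similitude (f i) (s i)) (N2 : (2 <= N)%N).
Hypotheses (pp : pos_prob_vector p) (muE : ISM f p nu mu) (r0 : 0 < r).
Hypothesis xiE : is_xi (fun i => p (lift ord0 i)) s r xi.
Hypothesis nurho : nu (~` @cball R q rho) = 0%E.
Hypothesis f_rho : forall i x, @cball R q rho x -> @cball R q rho (f i x).

Let p0 := p ord0.
Let w i := p (lift ord0 i).
Let kap := xi / (xi + r).
Let xi0 : 0 < xi := xiE.1.
Let kap0 : 0 < kap. Proof. by case/andP: (kappa01 r0 xi0). Qed.
Let kap1 : kap < 1. Proof. by case/andP: (kappa01 r0 xi0). Qed.
Let h1 : \sum_i (w i * s i `^ r) `^ kap = 1 := xiE.2.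
Let p0_gt0 : 0 < p0 := pp.1 ord0.
Let w_gt0 i : 0 < w i := pp.1 _.

Let pw1 : p0 + \sum_i w i = 1. Proof. by rewrite -pp.2 big_ord_recl. Qed.

Let mu_mix : mixture f p0 w nu mu. Proof. exact: muE. Qed.

Let w_le1 i : 0 < w i <= 1.
Proof.
rewrite w_gt0/= -pw1 (bigD1 i)//= addrCA lerDl addr_ge0 ?(ltW p0_gt0)//.
by apply: sumr_ge0 => j _; exact: ltW.
Qed.

Let h01 i : 0 < w i * s i `^ r < 1 := scaled_weight01 r0 (w_le1 i) (f_sim i).

Let murho : mu (~` @cball R q rho) = 0%E.
Proof.
apply: (self_similar_null (fun i => similitude_continuous (contractive_similitudeW (f_sim i)))
  (fun i => ltW (w_gt0 i)) _ mu_mix _ f_rho nurho).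
  by move: pw1 p0_gt0; lra.
by apply: closed_borel; exact: cball_closed.
Qed.

(** One share of points for [nu] in each of the [k] generations. *)
Lemma ISM_upper (A B : R) : 0 < A -> 0 < B ->
  (forall x, 1 <= x -> exists a : seq 'rV[R]_q, [/\ a != [::],
    (size a)%:R <= A * x `^ kap & (cost r nu [set` a] <= (B * x `^ (kap - 1))%:E)%E]) ->
  lesssim (fun n => (quant_error r mu n `^ r)%E)
    (fun n => (n%:R `^ (- (r / xi)) * ln n%:R `^ ((xi + r) / xi))%:E).
Proof.
move=> A0 B0 hnu.
have [hm [th [hm01 th01 hb]]] := finite_bounds01 h01.
have [[hm0 hm1] [th0 th1]] := (andP hm01, andP th01).
have hmV0 : 0 < hm^-1 by rewrite invr_gt0.
have rr0 : 0 <= rho `^ r := powR_ge0 _ _.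
pose A' := hm^-1 + A; pose B' := rho `^ r + B.
have A'1 : 1 <= A'.
  by rewrite -[leLHS]addr0 lerD ?(ltW A0)// invf_ge1.
have B'0 : 0 < B' by rewrite ltr_wpDl.
apply: (upper_asymptotics r0 xi0 A'1 B'0 th01) => k x x0 xth; rewrite -/kap.
have [hmx|/ltW xhm] := leP hm x; last first.
  exists [:: 0]; split=> //=.
    rewrite lerDr; apply: mulr_ge0; last exact: powR_ge0.
    by apply: mulr_ge0; [rewrite addr_ge0|exact: le_trans A'1].
  rewrite set_cons1; apply: le_trans (cost_origin r0 murho) _; rewrite lee_fin.
  apply: (@le_trans _ _ (B' * 1)); first by rewrite mulr1 lerDl ltW.
  apply: ler_pM => //; first exact: ltW.
    by rewrite ler_peMl ?(ltW B'0)// lerDl.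
  rewrite -[leLHS](powRr0 x); apply: ger_powR; last by rewrite subr_le0 ltW.
  by rewrite x0 (le_trans xhm).
have [||x' x'1|a [ane sa ca]] := upper_recursion (A := A') (B := B') (D := 1)
    f_sim (ltW p0_gt0) w_gt0 r0 mu_mix kap0 kap1 h1 hm01 th01 hb murho _ _ ler01 _ hmx xth.
- by rewrite -(mulVf (lt0r_neq0 hm0)) ler_pM2r// lerDl ltW.
- by rewrite lerDl ltW.
- have [a [ane sa ca]] := hnu x' x'1; exists a; split; first by right.
    by apply: le_trans sa _; rewrite mul1r ler_wpM2r ?powR_ge0// lerDr ltW.
  apply: (@le_trans _ _ (1%:E * (B' * x' `^ (kap - 1))%:E)%E); last by rewrite mul1e mul1r.
  apply: lee_pmul; rewrite ?lee_fin ?(ltW p0_gt0) ?cost_ge0//.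
    by rewrite -pw1 lerDl; apply: sumr_ge0 => j _; exact: ltW.
  by apply: le_trans ca _; rewrite lee_fin ler_wpM2r ?powR_ge0// lerDr.
exists a; split=> //; last by move: ca; rewrite mul1r.
by apply: le_trans sa _; rewrite mul1r lerDl.
Qed.

Section Lower.
Variable U : set 'rV[R]_q.
Hypotheses (fU : \bigcup_i (f i @` U) `<=` U) (tU : trivIset setT (fun i => f i @` U)).

Let UC : ~` U !=set0 := setC_nonempty f_sim N2 tU.

Let barrier_cost a v : a != [::] -> (v%:E <= cost r mu (barrier U a))%E ->
  (v%:E <= cost r mu [set` a])%E.
Proof.
move=> ane /le_trans; apply; apply: subset_cost => //; last by move=> x; left.
by case: (a) ane => // x l _; exists x; rewrite /= inE eqxx.
Qed.

Lemma ISM_lower (C : R) : 0 < C ->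
  (forall x a, 1 <= x ->
    ((C * (x `^ kap - (size a)%:R) / x)%:E <= cost r nu (barrier U a))%E) ->
  lesssim (fun n => (n%:R `^ (- (r / xi)) * ln n%:R)%:E)
    (fun n => (quant_error r mu n `^ r)%E).
Proof.
move=> C0 hnu.
have [hm [th [hm01 th01 hb]]] := finite_bounds01 h01.
have [hm0 hm1] := andP hm01.
have hbl i : hm <= w i * s i `^ r by have /andP[] := hb i.
have pC0 : 0 < p0 * C by exact: mulr_gt0.
apply: (lower_asymptotics r0 xi0 (c := p0 * C) (H := hm^-1)) => //.
  by rewrite invf_ge1.
move=> k x a ane hx; rewrite -/kap; apply: barrier_cost => //.
apply: (lower_mixture f_sim (ltW p0_gt0) w_gt0 r0 mu_mix fU tU UC h1 hm01 hbl
  (ltW pC0) _ a hx) => x' a' x'1.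
rewrite -!mulrA EFinM; apply: lee_wpmul2l; first by rewrite lee_fin ltW.
by rewrite mulrA; exact: hnu.
Qed.

(** [nu] is carried by a set [S] at distance at least [d] from the complement of
    [U] and from the pieces.  From a point of [S], the barrier is at least [eta]
    times as far as the barrier formed with the points of [a] outside the pieces
    and the open set [U'] adapted to [nu]. *)
Lemma ISM_lower_separated (S U' : set 'rV[R]_q) (d C : R) :
  measurable (S : set (borel R q)) -> nu (~` S) = 0%E -> S `<=` cball rho -> 0 < d ->
  (forall y z, S y -> (~` U `|` \bigcup_i (f i @` U)) z -> d <= enorm (y - z)) ->
  ~` U' !=set0 -> 0 < C ->
  (forall x a, 1 <= x ->
    ((C * (x `^ kap - (size a)%:R) / x)%:E <= cost r nu (barrier U' a))%E) ->
  gtrsim (fun n => (quant_error r mu n `^ r)%E)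
    (fun n => (n%:R `^ (- (r / xi)) * ln n%:R `^ ((xi + r) / xi))%:E).
Proof.
move=> mS nuS Srho d0 sep [z0 U'z0] C0 hnu.
have [hm [th [hm01 th01 hb]]] := finite_bounds01 h01.
have [hm0 hm1] := andP hm01.
have hbl i : hm <= w i * s i `^ r by have /andP[] := hb i.
(* [D] bounds the distance from [S] to [z0], a point outside [U'], and also
   exceeds [d], so that [eta <= 1]. *)
pose D := `|rho| + enorm z0 + d.
have D0 : 0 < D by rewrite ltr_wpDl// addr_ge0 ?enorm_ge0.
pose eta := d / D; have eta0 : 0 < eta by exact: divr_gt0.
have eta1 : eta <= 1 by rewrite ler_pdivrMr// mul1r lerDr addr_ge0 ?enorm_ge0.
have barrier'_ne a : barrier U' a !=set0 by exists z0; right.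
have barrier_ne a : barrier U a !=set0 by exact: barrier_nonempty.
have near_S y a : S y -> eta * dist_to y (barrier U' a) <= d.
  move=> Sy; rewrite -ler_pdivlMl// invf_div divfK ?gt_eqF//.
  apply: le_trans (dist_to_le y (_ : barrier U' a z0)) _; first by right.
  apply: le_trans (enormD _ _) _; rewrite enormN.
  have := Srho _ Sy; rewrite /cball/= => ?; have := ler_norm rho.
  by rewrite /D => ?; lra.
have compare (a a0 : seq 'rV[R]_q) :
    (forall y, y \in a -> (forall i, ~ (f i @` U) y) -> y \in a0) ->
    ((eta `^ r)%:E * cost r nu (barrier U' a0) <= cost r nu (barrier U a))%E.
  move=> ha0; rewrite -(cost_scale r nu (barrier'_ne a0) (ltW eta0)) cost.unlock.
  have m1 := measurable_dist_powR r (barrier'_ne a0).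
  have m2 := measurable_dist_powR r (barrier_ne a).
  have mm : measurable_fun [set: borel R q]
      (fun x => (eta * dist_to x (barrier U' a0)) `^ r).
    rewrite (_ : (fun x => _) = (fun x : borel R q =>
      eta `^ r * dist_to x (barrier U' a0) `^ r)); first exact: measurable_funM.
    by apply/funext => x; rewrite powRM ?dist_to_ge0 ?(ltW eta0).
  apply: (le_integral_null mS nuS mm m2) => [x|x|y Sy]; [exact: powR_ge0|exact: powR_ge0|].
  apply: ge0_ler_powR; rewrite ?nnegrE ?dist_to_ge0 ?(ltW r0)//.
    by rewrite mulr_ge0 ?dist_to_ge0 ?(ltW eta0).
  apply: le_dist_to => // z [za|Uz]; last first.
    by apply: le_trans (near_S _ _ Sy) _; apply: sep => //; left.
  have [[i fi]|nfi] := pselect (exists i, (f i @` U) z).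
    by apply: le_trans (near_S _ _ Sy) _; apply: sep => //; right; exists i.
  have za0 : z \in a0 by apply: ha0 => // i fi; apply: nfi; exists i.
  apply: (@le_trans _ _ (dist_to y (barrier U' a0))).
    by rewrite ler_piMl ?dist_to_ge0.
  by apply: dist_to_le; left.
have c0 : 0 < p0 * (eta `^ r * C) by rewrite !mulr_gt0// powR_gt0.
apply: (lower_asymptotics_separated r0 xi0 (c := p0 * (eta `^ r * C)) (H := hm^-1)) => //.
  by rewrite invf_ge1.
move=> k x a ane hx; rewrite -/kap; apply: barrier_cost => //.
apply: (lower_mixture_separated f_sim (ltW p0_gt0) w_gt0 r0 mu_mix fU tU UC h1 hm01 hbl
  (ltW c0) _ a hx) => x' a' a0 x'1 ha0.
rewrite -!mulrA EFinM; apply: lee_wpmul2l; first by rewrite lee_fin ltW.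
apply: le_trans (compare _ _ ha0); rewrite EFinM; apply: lee_wpmul2l.
  by rewrite lee_fin powR_ge0.
by rewrite mulrA; exact: hnu.
Qed.

End Lower.

End InhomogeneousSelfSimilar.

Theorem theorem1p2 (R : realType) (q N : nat) (hq : (1 <= q)%N) (hN : (2 <= N)%N)
    (f : 'I_N -> 'rV[R]_q -> 'rV[R]_q) (s : 'I_N -> R)
    (hf : forall i, contractive_similitude (f i) (s i))
    (E : set 'rV[R]_q) (hE : self_similar_set f E)
    (p : 'I_N.+1 -> R) (hp : pos_prob_vector p)
    (nu mu : probability (borel R q) R)
    (hnu : compact (msupport nu)) (hmu : ISM f p nu mu)
    (r : R) (hr : 0 < r) :
  (forall (t : 'I_N -> R) (xi1 xi2 : R),
      case_i f t nu ->
      is_xi t s r xi1 -> is_xi (fun i => p (lift ord0 i)) s r xi2 ->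
      xi1 = xi2 ->
      let xi := Num.max xi1 xi2 in
      lesssim (fun n => (n%:R `^ (- (r / xi)) * ln n%:R)%:E)
              (fun n => (quant_error r mu n `^ r)%E)
      /\
      lesssim (fun n => (quant_error r mu n `^ r)%E)
              (fun n => (n%:R `^ (- (r / xi)) * ln n%:R `^ ((xi + r) / xi))%:E))
  /\
  (forall (M : nat) (g : 'I_M -> 'rV[R]_q -> 'rV[R]_q) (c t : 'I_M -> R)
          (xi1 xi2 : R),
      case_ii f E g c t nu ->
      is_xi t c r xi1 -> is_xi (fun i => p (lift ord0 i)) s r xi2 ->
      xi1 = xi2 ->
      let xi := Num.max xi1 xi2 in
      asymp (fun n => (quant_error r mu n `^ r)%E)
            (fun n => (n%:R `^ (- (r / xi)) * ln n%:R `^ ((xi + r) / xi))%:E)).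
Proof.
have [/= rf hrf] := cball_stable hf.
have [/= rC hrC] := compact_cball hnu.
have null rho : rC <= rho -> nu (~` @cball R q rho) = 0%E.
  move=> /hrC sub; apply/eqP; rewrite eq_le measure_ge0 andbT -(msupport_null nu).
  apply: le_measure; rewrite ?inE.
  - by apply: measurableC; apply: closed_borel; exact: cball_closed.
  - by apply: measurableC; apply: closed_borel; exact: msupport_closed.
  - exact: subsetC.
split=> [t xi1 xi2 [osc tp nuE] xi1E xi2E e12|
         M g c t xi1 xi2 [M2 hg osc [tp nuE] [U [[_ Une oU] [fU tU] [_ CU] [_ Cf]]]] xi1E xi2E e12];
  rewrite e12 maxxx.
- pose rho := Num.max rf rC.
  have nurho : nu (~` @cball R q rho) = 0%E by apply: null; rewrite le_max lexx orbT.
  have frho := hrf rho ltac:(by rewrite le_max lexx).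
  rewrite e12 in xi1E.
  have kap01 := kappa01 hr xi2E.1.
  split.
    have [U [C [fU tU _ C0 hC]]] :=
      self_similar_lower hf hN tp nuE hr kap01 xi1E.2 nurho frho osc.
    exact: (ISM_lower hf hN hp hmu hr xi2E fU tU C0 hC).
  have [A [B [A0 B0 hAB]]] := self_similar_upper hf tp nuE hr kap01 xi1E.2 nurho.
  exact: (ISM_upper hf hp hmu hr xi2E nurho frho A0 B0 hAB).
- have [/= rg hrg] := cball_stable hg.
  pose rho := Num.max rg (Num.max rf rC).
  have rCrho : rC <= rho by rewrite !le_max lexx !orbT.
  have nurho := null _ rCrho.
  have frho := hrf rho ltac:(by rewrite !le_max lexx !orbT).
  have grho := hrg rho ltac:(by rewrite !le_max lexx).
  rewrite e12 in xi1E.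
  have kap01 := kappa01 hr xi2E.1.
  split.
    have [A [B [A0 B0 hAB]]] := self_similar_upper hg tp nuE hr kap01 xi1E.2 nurho.
    exact: (ISM_upper hf hp hmu hr xi2E nurho frho A0 B0 hAB).
  have [U' [C [gU' tU' U'C C0 hC]]] :=
    self_similar_lower hg M2 tp nuE hr kap01 xi1E.2 nurho grho osc.
  have UC := setC_nonempty hf hN tU.
  have [d0 [d00 hd0]] : exists d : R, 0 < d /\
      forall y, msupport nu y -> d <= dist_to y (~` U).
    apply: compact_dist_to => // y Cy; apply: open_dist_to_setC => //; exact: CU.
  (* Distance [0] to [f i @` U] would put a point in [f i @` closure U]. *)
  have hdi i : exists d : R, 0 < d /\ forall y, msupport nu y -> d <= dist_to y (f i @` U).
    apply: compact_dist_to => //; first exact: image_nonempty.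
    move=> y Cy; rewrite lt_def dist_to_ge0 andbT; apply/eqP => dy.
    have sf := contractive_similitudeW (hf i).
    have [x xy] := similitude_surj y sf.
    suff : (msupport nu `&` f i @` closure U) y by rewrite Cf.
    split=> //; exists x => //; apply: dist_to0_closure => //; apply/eqP.
    move: dy; rewrite -xy (dist_to_similitude _ sf)// => /eqP.
    by rewrite mulf_eq0 gt_eqF ?sf.1.
  have [di hdi'] := choice hdi.
  have di01 i : 0 < Num.min (di i) 2^-1 < 1.
    rewrite lt_min (hdi' i).1 invr_gt0 ltr0n/= gt_min; apply/orP; right.
    by rewrite invf_lt1 ?ltr1n.
  have [dm [dM [/andP[dm0 _] _ hdm]]] := finite_bounds01 di01.
  apply: (ISM_lower_separated (S := msupport nu) (d := Num.min d0 dm)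
    (rho := rho)
    hf hN hp hmu hr xi2E fU tU _ _ _ _ _ U'C C0 hC).
  - by apply: closed_borel; exact: msupport_closed.
  - exact: msupport_null.
  - exact: hrC.
  - by rewrite lt_min d00.
  - move=> y z Cy [Uz|[i _ fUz]]; rewrite ge_min; apply/orP; [left|right].
      exact: le_trans (hd0 y Cy) (dist_to_le y Uz).
    apply: le_trans (dist_to_le y fUz); apply: le_trans ((hdi' i).2 y Cy).
    have /andP[/le_trans hle _] := hdm i.
    by apply: hle; rewrite ge_min lexx.
Qed.
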